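(* The focal submanifolds $M_+$ of OT-FKM type in the following cases admit complex structures: (i) $M_+$ of OT-FKM type with $m=2$. Consequently, the isoparametric hypersurface $M\cong M_+\times S^2$ of OT-FKM type with $m=2$ is a complex manifold (i.e. admits a complex structure). (ii) $M_+$ of OT-FKM type with $m=4$ in the definite case.
   Context: OT-FKM type: Let $\{P_0,\dots,P_m\}$, $m\ge 1$, be a symmetric Clifford system on $\mathbb{R}^{2l}$, i.e. symmetric $2l\times 2l$ real matrices with $P_iP_j+P_jP_i=2\delta_{ij}I_{2l}$. Here $l=k\delta(m)$ with $k$ a positive integer, $\delta(m)$ being the dimension of the irreducible module of the Clifford algebra $\mathcal{C}_{m-1}$ ($\delta(2)=2$, $\delta(4)=4$), and it is assumed that $l-m-1>0$. Define $F(x)=|x|^4-2\sum_{i=0}^m\langle P_ix,x\rangle^2$ on $\mathbb{R}^{2l}$ and $f=F|_{S^{2l-1}(1)}$, with image $[-1,1]$. The isoparametric hypersurface of OT-FKM type is a regular level set $M=f^{-1}(c)$, $-1<c<1$, and $$M_+=f^{-1}(1)=\{x\in S^{2l-1}(1) : \langle P_0x,x\rangle=\cdots=\langle P_mx,x\rangle=0\}.$$ $M$ is diffeomorphic to $S^m\times M_+$. When $m\equiv 0\pmod 4$, the definite case is the case $P_0P_1\cdots P_m=\pm I_{2l}$. A complex structure on a manifold is an integrable almost complex structure (an endomorphism $J$ of the tangent bundle with $J^2=-\mathrm{Id}$ and vanishing Nijenhuis tensor). *)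

(* Defs.v *)
(* MathComp-Analysis, over an arbitrary R : realType. *)
From HB Require Import structures.
From mathcomp Require Import all_boot all_order all_algebra.
From mathcomp Require Import all_classical all_reals all_analysis.
Set Implicit Arguments.
Unset Strict Implicit.
Unset Printing Implicit Defensive.
Import Order.TTheory GRing.Theory Num.Theory numFieldNormedType.Exports.
Local Open Scope classical_set_scope.
Local Open Scope ring_scope.

(** Smooth maps.  [Ck_on] is meant for open [U] and finite-dimensional [V], so
    that the directional derivatives determine the differential. *)

Fixpoint Ck_on (R : realType) (V W : normedModType R) (k : nat)
    (U : set V) (f : V -> W) : Prop :=
  match k with
  | 0%N => forall x, U x -> {for x, continuous f}
  | k'.+1 => (forall x, U x -> differentiable f x) /\
             (forall v : V, Ck_on k' U (fun x => 'D_v f x))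
  end.

Definition smooth_on (R : realType) (V W : normedModType R)
    (U : set V) (f : V -> W) : Prop := forall k : nat, Ck_on k U f.

(* Smoothness of a map defined on an arbitrary subset A of V: existence of local
   smooth extensions.  Only the values of f on A matter. *)
Definition smooth_along (R : realType) (V W : normedModType R)
    (A : set V) (f : V -> W) : Prop :=
  forall x, A x -> exists (U : set V) (g : V -> W),
    [/\ open U, U x, smooth_on U g & forall y, A y -> U y -> g y = f y].

Definition diffeomorphic (R : realType) (V W : normedModType R)
    (A : set V) (B : set W) : Prop :=
  exists (f : V -> W) (g : W -> V),
    [/\ smooth_along A f, smooth_along B g,
        forall x, A x -> B (f x) /\ g (f x) = x &
        forall y, B y -> A (g y) /\ f (g y) = y].

(** Embedded submanifolds of R^n, their tangent spaces, complex structures. *)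

(* A is locally the zero set of a submersion to R^p. *)
Definition is_submanifold (R : realType) (n : nat) (A : set 'cV[R]_n) : Prop :=
  exists p : nat, forall x, A x ->
    exists (U : set 'cV[R]_n) (G : 'cV[R]_n -> 'cV[R]_p),
      [/\ open U, U x, smooth_on U G,
          forall y, U y -> (A y <-> G y = 0) &
          forall w : 'cV[R]_p, exists v : 'cV[R]_n, 'D_v G x = w].

(* v is the velocity at time 0 of a smooth curve in A passing through x. *)
Definition tangent (R : realType) (n : nat) (A : set 'cV[R]_n)
    (x v : 'cV[R]_n) : Prop :=
  exists (I : set R) (gamma : R -> 'cV[R]_n),
    [/\ open I, I 0, smooth_on I gamma, forall t, I t -> A (gamma t) &
        gamma 0 = x /\ 'D_1 gamma 0 = v].

Definition lie_bracket (R : realType) (n : nat)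
    (X Y : 'cV[R]_n -> 'cV[R]_n) (x : 'cV[R]_n) : 'cV[R]_n :=
  'D_(X x) Y x - 'D_(Y x) X x.

Definition nijenhuis (R : realType) (n : nat) (J : 'cV[R]_n -> 'M[R]_n)
    (X Y : 'cV[R]_n -> 'cV[R]_n) (x : 'cV[R]_n) : 'cV[R]_n :=
  let JX := fun y => J y *m X y in
  let JY := fun y => J y *m Y y in
  lie_bracket JX JY x - J x *m lie_bracket JX Y x
    - J x *m lie_bracket X JY x - lie_bracket X Y x.

(* The endomorphism J_x of T_x A is represented by any matrix J x which restricts
   to it on T_x A. *)
Definition almost_complex_structure (R : realType) (n : nat)
    (A : set 'cV[R]_n) (J : 'cV[R]_n -> 'M[R]_n) : Prop :=
  smooth_along A J /\
  forall x v, A x -> tangent A x v ->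
    tangent A x (J x *m v) /\ J x *m (J x *m v) = - v.

(* The Nijenhuis tensor is computed from local smooth extensions J', X, Y to an
   open set of R^n of J and of vector fields on A; on A, brackets of extensions
   of tangent fields depend only on the fields along A. *)
Definition integrable (R : realType) (n : nat)
    (A : set 'cV[R]_n) (J : 'cV[R]_n -> 'M[R]_n) : Prop :=
  forall (U : set 'cV[R]_n) (J' : 'cV[R]_n -> 'M[R]_n)
         (X Y : 'cV[R]_n -> 'cV[R]_n),
    open U -> smooth_on U J' -> smooth_on U X -> smooth_on U Y ->
    (forall y, A y -> U y ->
       [/\ J' y = J y, tangent A y (X y) & tangent A y (Y y)]) ->
    forall x, A x -> U x -> nijenhuis J' X Y x = 0.

Definition admits_complex_structure (R : realType) (n : nat)
    (A : set 'cV[R]_n) : Prop :=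
  is_submanifold A /\
  exists J : 'cV[R]_n -> 'M[R]_n, almost_complex_structure A J /\ integrable A J.

(** Euclidean geometry (the library norm on matrices is the sup norm). *)

Definition dot (R : realType) (n : nat) (u v : 'cV[R]_n) : R :=
  \sum_(i < n) u i 0 * v i 0.

Definition unit_sphere (R : realType) (n : nat) : set 'cV[R]_n :=
  [set x | dot x x = 1].

Definition set_prod (R : realType) (n p : nat)
    (A : set 'cV[R]_n) (B : set 'cV[R]_p) : set 'cV[R]_(n + p) :=
  [set z | A (usubmx z) /\ B (dsubmx z)].

(** Clifford systems and the OT-FKM family. *)

(* Modules over the real Clifford algebra with p generators of square -1. *)
Definition clifford_module (R : realType) (p d : nat)
    (E : 'I_p -> 'M[R]_d) : Prop :=
  forall i j, E i *m E j + E j *m E i = (- ((i == j)%:R *+ 2))%:M.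

Definition irreducible_clifford_module (R : realType) (p d : nat)
    (E : 'I_p -> 'M[R]_d) : Prop :=
  [/\ clifford_module E, (0 < d)%N &
      forall W : 'M[R]_d, (forall i, stablemx W (E i)) ->
        W = 0 \/ row_full W].

(* d = delta(m) *)
Definition clifford_dim (R : realType) (m d : nat) : Prop :=
  exists E : 'I_m.-1 -> 'M[R]_d, irreducible_clifford_module E.

Definition symmetric_clifford_system (R : realType) (m l : nat)
    (P : 'I_m.+1 -> 'M[R]_(2 * l)) : Prop :=
  (forall i, (P i)^T = P i) /\
  (forall i j, P i *m P j + P j *m P i = ((i == j)%:R *+ 2)%:M).

Definition OT_FKM (R : realType) (m l : nat)
    (P : 'I_m.+1 -> 'M[R]_(2 * l)) : Prop :=
  [/\ (1 <= m)%N, symmetric_clifford_system P,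
      exists k d : nat, [/\ (0 < k)%N, clifford_dim R m d & l = (k * d)%N] &
      (m + 1 < l)%N].

Definition definite (R : realType) (m l : nat)
    (P : 'I_m.+1 -> 'M[R]_(2 * l)) : Prop :=
  \big[mulmx/1%:M]_(i < m.+1) P i = 1%:M \/
  \big[mulmx/1%:M]_(i < m.+1) P i = - 1%:M.

Definition FKM_poly (R : realType) (m l : nat)
    (P : 'I_m.+1 -> 'M[R]_(2 * l)) (x : 'cV[R]_(2 * l)) : R :=
  dot x x ^+ 2 - 2 * \sum_(i < m.+1) dot (P i *m x) x ^+ 2.

Definition FKM_level (R : realType) (m l : nat)
    (P : 'I_m.+1 -> 'M[R]_(2 * l)) (c : R) : set 'cV[R]_(2 * l) :=
  [set x | unit_sphere x /\ FKM_poly P x = c].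

(* M_+ *)
Definition focal_plus (R : realType) (m l : nat)
    (P : 'I_m.+1 -> 'M[R]_(2 * l)) : set 'cV[R]_(2 * l) := FKM_level P 1.

(* Main.v *)
Require Import Defs.
From HB Require Import structures.
From mathcomp Require Import all_boot all_order all_algebra.
From mathcomp Require Import all_classical all_reals all_analysis.
From mathcomp Require Import ring lra.
Set Implicit Arguments.
Unset Strict Implicit.
Unset Printing Implicit Defensive.
Import Order.TTheory GRing.Theory Num.Theory numFieldNormedType.Exports.
Local Open Scope classical_set_scope.
Local Open Scope ring_scope.

(** The focal submanifolds of the statement are transverse to the leaves of a
    holomorphic foliation and inherit the complex structure of the space of
    leaves; the hypersurfaces are products of a focal submanifold and a sphere.

    The matrix [J0 = P_0 P_1 P_2] squares to [-1] and commutes with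
    [P_0, P_1, P_2], so R^(2l) becomes C^l.  Under this identification and for
    [m = 2] the points of [M_+] are, up to a scalar, the orthonormal pairs of
    vectors of C^(l/2), that is, the matrices X with two columns such that X*X
    is scalar.  The group GL_2(C) acts on the pairs of independent vectors by
    linear maps which are polynomials in the [P_i], and it is the product of U(2) with the subgroup B
    whose Lie algebra is spanned over C by [(1 + P_0) P_1] (nilpotent) and
    [1 + P_1 P_2] (diagonal).  The orbits of B are holomorphic, and they are
    transverse to [M_+] and of complementary dimension.  Hence [M_+] inherits
    the complex structure of the space of orbits: [J_x] is multiplication by
    [J0] followed by the projection [frame_proj x] onto the tangent space along
    the orbit of B.  Both are polynomial in [x].  In the definite case with
    [m = 4] one has [P_4 = +- P_3 J0], so the two further equations say that
    the holomorphic quadratic form with real part [<P_3 x, x>] vanishes; B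
    preserves this hypersurface, and the same formula for [J_x] works inside it.

    Integrability is reduced to algebra.  For an endomorphism field J defined
    on an open set, the Nijenhuis tensor of two tangent fields takes at a point
    the value [nij_form], which only involves the values of the fields there
    and the first derivatives of J ([nijenhuis_nij_form]).  This value is
    tangent, hence fixed by the projection, and [frame_nij] shows that the
    projection kills it: this uses that the vector fields of B commute with
    [J0] and are closed under brackets.

    A level hypersurface M is carried onto [M_+ x S^2] by polynomial maps.  If
    [s^2 = (1 - c) / 2], the vector of the [<P_i x, x>] has norm s on M; dividing
    it by s gives the point u of the sphere, and with [Q = sum_i u_i P_i], whose
    square is 1, one has [x = a y + b Q y] for a unique y in [M_+], where
    [a^2 + b^2 = 1] and [2 a b = s].  The sphere carries the rotation by a right
    angle [w |-> p x w], the product carries the block sum of the two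
    structures, and M receives the pulled back structure ([pull_J]).  Its
    integrability follows from the naturality of brackets, where the symmetry
    of second derivatives ([schwarz]) enters.

    Two facts of analysis support this.  Smoothness is proved by coinduction:
    a class of differentiable functions closed under directional derivatives
    consists of smooth functions ([smooth_on_coind]).  Tangent spaces are
    defined by curves, so every solution of the linearized equations has to be
    realized as a velocity; the curves are obtained by retracting straight
    lines onto the quadric ([quadric_curve]), by a formula valid for every
    Clifford system, including the empty one, which gives the sphere. *)

(** * Rules of differentiation *)

Section Differentials.
Variables (R : realType) (V : normedModType R).
Implicit Types (x v : V).

Lemma is_diff_derive (W : normedModType R) (f df : V -> W) x v :
  is_diff x f df -> 'D_v f x = df v.
Proof. by move=> [d <-]; rewrite deriveE. Qed.

Lemma is_diff_differentiable (W : normedModType R) (f df : V -> W) x :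
  is_diff x f df -> differentiable f x.
Proof. by case. Qed.

Lemma is_diff_ext (W : normedModType R) (f df dg : V -> W) x :
  is_diff x f df -> df =1 dg -> is_diff x f dg.
Proof. by move=> h e; apply: is_diff_eq => //; apply/funext. Qed.

Lemma is_diff_const (W : normedModType R) (c : W) x :
  is_diff x (fun=> c) (fun=> 0).
Proof. exact: is_diff_cst. Qed.

Lemma is_diff_add (W : normedModType R) (f g df dg : V -> W) x :
  is_diff x f df -> is_diff x g dg ->
  is_diff x (fun y => f y + g y) (fun v => df v + dg v).
Proof. exact: is_diffD. Qed.

Lemma is_diff_opp (W : normedModType R) (f df : V -> W) x :
  is_diff x f df -> is_diff x (fun y => - f y) (fun v => - df v).
Proof. exact: is_diffN. Qed.

Lemma is_diff_mul (f g df dg : V -> R) x :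
  is_diff x f df -> is_diff x g dg ->
  is_diff x (fun y => f y * g y) (fun v => df v * g x + f x * dg v).
Proof.
move=> hf hg; have h := is_diffM hf hg.
apply: (is_diff_ext h) => v.
by rewrite [RHS]addrC [df v * _]mulrC.
Qed.

Lemma is_diff_sum (W : normedModType R) (I : finType) (f df : I -> V -> W) x :
  (forall i, is_diff x (f i) (df i)) ->
  is_diff x (fun y => \sum_i f i y) (fun v => \sum_i df i v).
Proof.
move=> h.
have -> : (fun y => \sum_i f i y) = \sum_i f i.
  by apply/funext => y; rewrite fct_sumE.
have -> : (fun y => \sum_i df i y) = \sum_i df i.
  by apply/funext => y; rewrite fct_sumE.
apply: (@big_ind2 _ _ (fun f df => is_diff x f df)) => //.
- exact: is_diff_cst.
- by move=> *; exact: is_diffD.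
Qed.

Lemma is_diff_chain (W Z : normedModType R) (f df : V -> W) (g dg : W -> Z) x :
  is_diff x f df -> is_diff (f x) g dg ->
  is_diff x (fun y => g (f y)) (fun v => dg (df v)).
Proof. by move=> hf hg; exact: (@is_diff_comp _ _ _ _ _ _ _ _ _ hf hg). Qed.

Lemma is_diff_inv (f df : V -> R) x :
  is_diff x f df -> f x != 0 ->
  is_diff x (fun y => (f y)^-1) (fun v => - (f x) ^- 2 * df v).
Proof.
move=> [hf <-] n0; apply: DiffDef; first exact: differentiableV.
by rewrite diffV.
Qed.

Lemma is_diff_sqrt (f df : V -> R) x :
  is_diff x f df -> 0 < f x ->
  is_diff x (fun y => Num.sqrt (f y)) (fun v => df v / (2 * Num.sqrt (f x))).
Proof.
move=> hf f0.
have [h1 h2] := is_derive1_sqrt f0.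
have hs : is_diff (f x) Num.sqrt (fun v : R => v / (2 * Num.sqrt (f x))).
  have ds : differentiable (Num.sqrt : R -> R) (f x) by apply/derivable1_diffP.
  apply: DiffDef => //; apply/funext => v.
  have -> : 'd Num.sqrt (f x) v = 'd Num.sqrt (f x) (v *: 1 : R) :> R.
    by rewrite /GRing.scale /= mulr1.
  by rewrite linearZ -deriveE // h2.
exact: (is_diff_chain hf hs).
Qed.

Lemma is_diff_coord m n (f df : V -> 'M[R]_(m, n)) x i j :
  is_diff x f df -> is_diff x (fun y => f y i j) (fun v => df v i j).
Proof.
move=> [hf <-].
have dc : differentiable (fun y => f y i j) x.
  exact: (@differentiable_comp _ _ _ _ f (fun M : 'M[R]_(m, n) => M i j) x hf
    (differentiable_coord _ i j)).
apply: DiffDef => //; apply/funext => v.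
rewrite -!deriveE // derive_mx ?mxE //; exact: diff_derivable.
Qed.

(** A matrix-valued map is the finite sum of its entries times constant
    matrices, so differentiability is entrywise. *)
Lemma is_diff_mx m n (f df : V -> 'M[R]_(m, n)) x :
  (forall i j, is_diff x (fun y => f y i j) (fun v => df v i j)) ->
  is_diff x f df.
Proof.
move=> h.
have e (M : V -> 'M[R]_(m, n)) :
    M = (fun y => \sum_i \sum_j M y i j *: delta_mx i j).
  by apply/funext => y; exact: matrix_sum_delta.
rewrite (e f) (e df); do 2![apply: is_diff_sum => ?].
have hZl (k dk : V -> R) (A : 'M[R]_(m,n)) : is_diff x k dk ->
    is_diff x (fun z => k z *: A) (fun v => dk v *: A).
  move=> [hk <-]; apply: DiffDef; first exact: differentiableZl.
  exact: diffZl.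
exact: hZl.
Qed.

(** The first-order expansion of one function at [x] is verbatim an expansion of
    the other, since the remainder only matters near [x]. *)
Lemma near_eq_differentiable (W : normedModType R) (f g : V -> W) x :
  (\near x, f x = g x) -> differentiable f x -> differentiable g x.
Proof.
move=> fg df.
have e : g \o shift x = cst (g x) + 'd f x +o_ 0 id.
  apply/eqaddoP => _/posnumP[e].
  have [_ /eqaddoP h] := (diff_locallyP x f).1 df.
  have hfx : f x = g x by exact: nbhs_singleton fg.
  have fg0 : \forall y \near (0 : V), f (y + x) = g (y + x).
    by move: fg; rewrite (near_shift 0) /= subr0.
  near=> y.
  have -> : (g \o shift x - (cst (g x) + 'd f x)) y =
            (f \o shift x - (cst (f x) + 'd f x)) y.
    by rewrite !fctE /= hfx; congr (_ - _); apply/esym; near: y.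
  near: y; exact: h.
apply/diff_locallyP.
have c : continuous ('d f x) by exact: diff_continuous.
by rewrite (diff_unique c e).
Unshelve. all: by end_near. Qed.

End Differentials.

(** * Closure properties of smooth maps *)

Section Smooth.
Variables (R : realType) (V : normedModType R) (U : set V).
Hypothesis openU : open U.

Lemma Ck_on_ext (W : normedModType R) k (f g : V -> W) :
  (forall x, U x -> f x = g x) -> Ck_on k U f -> Ck_on k U g.
Proof.
elim: k f g => [|k IH] f g fg.
  move=> fc x Ux; have fgx : \forall y \near x, f y = g y.
    by apply: filterS (open_nbhs_nbhs (conj openU Ux)) => y /fg.
  rewrite /prop_for /continuous_at -(fg x Ux); apply: cvg_trans (fc x Ux).
  exact: near_eq_cvg.
move=> [fd fk]; have fgx x : U x -> \forall y \near x, f y = g y.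
  by move=> Ux; apply: filterS (open_nbhs_nbhs (conj openU Ux)) => y /fg.
split=> [x Ux|v]; first exact: near_eq_differentiable (fgx x Ux) (fd x Ux).
by apply: IH (fk v) => x Ux; apply: near_eq_derive; exact: fgx.
Qed.

(** The coinduction principle behind all smoothness proofs: the derivatives are
    only compared on [U], since outside [U] directional derivatives may be
    meaningless. *)
Lemma smooth_on_coind (W : normedModType R) (P : (V -> W) -> Prop) f :
  (forall f, P f -> (forall x, U x -> differentiable f x) /\
     forall v, exists2 g, P g & forall x, U x -> g x = 'D_v f x) ->
  P f -> smooth_on U f.
Proof.
move=> hP Pf k; elim: k f Pf => [|k IH] f Pf.
  by move=> x Ux; apply: differentiable_continuous; exact: (hP f Pf).1.
have [fd fD] := hP f Pf; split=> // v.
by have [g Pg eg] := fD v; exact: Ck_on_ext eg (IH g Pg).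
Qed.

Lemma smooth_on_diff (W : normedModType R) (f : V -> W) x :
  smooth_on U f -> U x -> differentiable f x.
Proof. by move=> sf; have [h _] := sf 1%N; exact: h. Qed.

Lemma smooth_on_D (W : normedModType R) (f : V -> W) v :
  smooth_on U f -> smooth_on U (fun x => 'D_v f x).
Proof. by move=> sf k; have [_ h] := sf k.+1; exact: h. Qed.

Lemma smooth_on_is_diff (W : normedModType R) (f : V -> W) x :
  smooth_on U f -> U x -> is_diff x f (fun v => 'D_v f x).
Proof.
move=> sf Ux; have d := smooth_on_diff sf Ux; apply: DiffDef => //.
by apply/funext => v; rewrite deriveE.
Qed.

Lemma smooth_on_const (W : normedModType R) (c : W) : smooth_on U (fun=> c).
Proof.
apply: (@smooth_on_coind _ (fun f => exists c, f = fun=> c)); last by exists c.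
move=> _ [a ->]; split=> [x _|v]; first exact: differentiable_cst.
by exists (fun=> 0); [exists 0|move=> x _; rewrite derive_cst].
Qed.

(** The derivative is constant, and constants have all derivatives zero. *)
Lemma smooth_on_affine (W : normedModType R) (f df : V -> W) :
  (forall x, is_diff x f df) -> smooth_on U f.
Proof.
move=> hf; apply: (@smooth_on_coind _ (fun g => g = f \/ smooth_on U g)).
  move=> g [->|sg]; split.
  - by move=> x _; exact: (is_diff_differentiable (hf x)).
  - move=> v; exists (fun=> df v); first by right; exact: smooth_on_const.
    by move=> x _; rewrite (is_diff_derive v (hf x)).
  - by move=> x; exact: smooth_on_diff.
  - by move=> v; exists (fun x => 'D_v g x); first by right; exact: smooth_on_D.
by left.
Qed.

(** The expressions built from smooth functions by the field operations and
    square roots.  The class is closed under directional derivatives by the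
    usual rules, which makes it a candidate for coinduction and gives the
    stability of smoothness under all these operations at once. *)
Inductive smooth_alg : (V -> R) -> Prop :=
| smooth_alg_base f : smooth_on U f -> smooth_alg f
| smooth_alg_add f g : smooth_alg f -> smooth_alg g -> smooth_alg (fun x => f x + g x)
| smooth_alg_mul f g : smooth_alg f -> smooth_alg g -> smooth_alg (fun x => f x * g x)
| smooth_alg_inv f : (forall x, U x -> f x != 0) -> smooth_alg f ->
    smooth_alg (fun x => (f x)^-1)
| smooth_alg_sqrt f : (forall x, U x -> 0 < f x) -> smooth_alg f ->
    smooth_alg (fun x => Num.sqrt (f x)).

Lemma smooth_alg_smooth f : smooth_alg f -> smooth_on U f.
Proof.
apply: smooth_on_coind => {}f sf.
suff [df df_ hdf] : exists2 df : V -> V -> R,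
    (forall x, U x -> is_diff x f (fun v => df v x)) &
    forall v, smooth_alg (df v).
  split=> [x Ux|v]; first exact: (is_diff_differentiable (df_ x Ux)).
  by exists (df v) => // x Ux; rewrite (is_diff_derive v (df_ x Ux)).
elim: sf => {f}.
- move=> f sf; exists (fun v x => 'D_v f x) => [x|v]; first exact: smooth_on_is_diff.
  by constructor; exact: smooth_on_D.
- move=> f g sf [df hf sdf] sg [dg hg sdg].
  exists (fun v x => df v x + dg v x) => [x Ux|v]; last exact: smooth_alg_add.
  exact: is_diff_add (hf x Ux) (hg x Ux).
- move=> f g sf [df hf sdf] sg [dg hg sdg].
  exists (fun v x => df v x * g x + f x * dg v x) => [x Ux|v].
    exact: is_diff_mul (hf x Ux) (hg x Ux).
  by apply: smooth_alg_add; apply: smooth_alg_mul.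
- move=> f n0 sf [df hf sdf].
  exists (fun v x => (-1 * ((f x)^-1 * (f x)^-1)) * df v x) => [x Ux|v].
    apply: (is_diff_ext (is_diff_inv (hf x Ux) (n0 x Ux))) => v.
    by rewrite mulN1r expr2 invfM.
  apply: smooth_alg_mul => //; apply: smooth_alg_mul; first by constructor; exact: smooth_on_const.
  by apply: smooth_alg_mul; apply: smooth_alg_inv.
- move=> f n0 sf [df hf sdf].
  exists (fun v x => df v x * (2 * Num.sqrt (f x))^-1) => [x Ux|v].
    exact: (is_diff_sqrt (hf x Ux) (n0 x Ux)).
  apply: smooth_alg_mul => //; apply: smooth_alg_inv.
    by move=> x Ux; rewrite mulf_neq0 ?pnatr_eq0 // gt_eqF ?sqrtr_gt0 ?n0.
  by apply: smooth_alg_mul; [constructor; exact: smooth_on_const|exact: smooth_alg_sqrt].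
Qed.

Lemma smooth_on_add (f g : V -> R) :
  smooth_on U f -> smooth_on U g -> smooth_on U (fun x => f x + g x).
Proof. by move=> sf sg; apply/smooth_alg_smooth/smooth_alg_add; constructor. Qed.

Lemma smooth_on_mul (f g : V -> R) :
  smooth_on U f -> smooth_on U g -> smooth_on U (fun x => f x * g x).
Proof. by move=> sf sg; apply/smooth_alg_smooth/smooth_alg_mul; constructor. Qed.

Lemma smooth_on_inv (f : V -> R) : (forall x, U x -> f x != 0) ->
  smooth_on U f -> smooth_on U (fun x => (f x)^-1).
Proof. by move=> f0 sf; apply/smooth_alg_smooth/smooth_alg_inv => //; constructor. Qed.

Lemma smooth_on_sqrt (f : V -> R) : (forall x, U x -> 0 < f x) ->
  smooth_on U f -> smooth_on U (fun x => Num.sqrt (f x)).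
Proof. by move=> f0 sf; apply/smooth_alg_smooth/smooth_alg_sqrt => //; constructor. Qed.

Lemma smooth_on_sum (I : finType) (f : I -> V -> R) :
  (forall i, smooth_on U (f i)) -> smooth_on U (fun x => \sum_i f i x).
Proof.
move=> sf; rewrite (_ : (fun x => _) = \sum_i f i); last first.
  by apply/funext => x; rewrite fct_sumE.
apply: big_ind => // [|f1 f2]; [exact: smooth_on_const|exact: smooth_on_add].
Qed.

Section Matrix.
Variables (m n : nat).
Implicit Types f g : V -> 'M[R]_(m, n).

Lemma smooth_on_coord f i j :
  smooth_on U f -> smooth_on U (fun x => f x i j).
Proof.
move=> sf; apply: (@smooth_on_coind _ (fun h =>
  exists2 f : V -> 'M[R]_(m, n), smooth_on U f & h = fun x => f x i j)).
  move=> _ [g sg ->]; have hd x (Ux : U x) :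
      is_diff x (fun x => g x i j) (fun v => 'D_v g x i j).
    exact: is_diff_coord (smooth_on_is_diff sg Ux).
  split=> [x Ux|v]; first exact: is_diff_differentiable (hd x Ux).
  exists (fun x => 'D_v g x i j); last by move=> x /hd /(is_diff_derive v) ->.
  by exists (fun x => 'D_v g x) => //; exact: smooth_on_D.
by exists f.
Qed.

Lemma smooth_on_mx f :
  (forall i j, smooth_on U (fun x => f x i j)) -> smooth_on U f.
Proof.
apply: (@smooth_on_coind _ (fun f => forall i j, smooth_on U (fun x => f x i j))).
move=> {}f sf.
have hd x (Ux : U x) : is_diff x f (fun v => \matrix_(i, j) 'D_v (fun x => f x i j) x).
  apply: is_diff_mx => i j; apply: (is_diff_ext (smooth_on_is_diff (sf i j) Ux)).
  by move=> v; rewrite mxE.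
split=> [x Ux|v]; first exact: is_diff_differentiable (hd x Ux).
exists (fun x => \matrix_(i, j) 'D_v (fun x => f x i j) x); last first.
  by move=> x /hd /(is_diff_derive v) ->.
move=> i j; rewrite (_ : (fun x => _) = fun x => 'D_v (fun x => f x i j) x).
  exact: smooth_on_D.
by apply/funext => x; rewrite mxE.
Qed.

Lemma smooth_on_addmx f g :
  smooth_on U f -> smooth_on U g -> smooth_on U (fun x => f x + g x).
Proof.
move=> sf sg; apply: smooth_on_mx => i j.
rewrite (_ : (fun x => _) = fun x => f x i j + g x i j).
  by apply: smooth_on_add; exact: smooth_on_coord.
by apply/funext => x; rewrite mxE.
Qed.

Lemma smooth_on_scalemx (k : V -> R) f :
  smooth_on U k -> smooth_on U f -> smooth_on U (fun x => k x *: f x).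
Proof.
move=> sf sg; apply: smooth_on_mx => i j.
rewrite (_ : (fun x => _) = fun x => k x * f x i j).
  by apply: smooth_on_mul => //; exact: smooth_on_coord.
by apply/funext => x; rewrite mxE.
Qed.

Lemma smooth_on_oppmx f : smooth_on U f -> smooth_on U (fun x => - f x).
Proof.
move=> sf; rewrite (_ : (fun x => _) = fun x => (-1) *: f x).
  by apply: smooth_on_scalemx => //; exact: smooth_on_const.
by apply/funext => x; rewrite scaleN1r.
Qed.

Lemma smooth_on_summx (I : finType) (f : I -> V -> 'M[R]_(m, n)) :
  (forall i, smooth_on U (f i)) -> smooth_on U (fun x => \sum_i f i x).
Proof.
move=> sf; rewrite (_ : (fun x => _) = \sum_i f i); last first.
  by apply/funext => x; rewrite fct_sumE.
apply: big_ind => // [|f1 f2]; [exact: smooth_on_const|exact: smooth_on_addmx].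
Qed.

End Matrix.

Lemma smooth_on_trmx m n (f : V -> 'M[R]_(m, n)) :
  smooth_on U f -> smooth_on U (fun x => (f x)^T).
Proof.
move=> sf; apply: smooth_on_mx => i j.
rewrite (_ : (fun x => _) = fun x => f x j i); first exact: smooth_on_coord.
by apply/funext => x; rewrite mxE.
Qed.

Lemma smooth_on_mulmx m n p (f : V -> 'M[R]_(m, n)) (g : V -> 'M[R]_(n, p)) :
  smooth_on U f -> smooth_on U g -> smooth_on U (fun x => f x *m g x).
Proof.
move=> sf sg; apply: smooth_on_mx => i j.
rewrite (_ : (fun x => _) = fun x => \sum_k f x i k * g x k j).
  by apply: smooth_on_sum => k; apply: smooth_on_mul; exact: smooth_on_coord.
by apply/funext => x; rewrite mxE.
Qed.

Lemma smooth_on_id : smooth_on U id.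
Proof. by apply: (@smooth_on_affine _ _ id) => x; exact: is_diff_id. Qed.

End Smooth.

(** * The Euclidean product *)

Section Dot.
Variables (R : realType) (n : nat).
Implicit Types u v w : 'cV[R]_n.

Lemma dotC u v : dot u v = dot v u.
Proof. by apply: eq_bigr => i _; rewrite mulrC. Qed.

Lemma dotDr u v w : dot u (v + w) = dot u v + dot u w.
Proof. by rewrite -big_split; apply: eq_bigr => i _; rewrite mxE mulrDr. Qed.

Lemma dotZr a u v : dot u (a *: v) = a * dot u v.
Proof. by rewrite /dot mulr_sumr; apply: eq_bigr => i _; rewrite mxE mulrCA. Qed.

Lemma dotNr u v : dot u (- v) = - dot u v.
Proof. by rewrite -scaleN1r dotZr mulN1r. Qed.

Lemma dotBr u v w : dot u (v - w) = dot u v - dot u w.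
Proof. by rewrite dotDr dotNr. Qed.

Lemma dotDl u v w : dot (u + v) w = dot u w + dot v w.
Proof. by rewrite dotC dotDr !(dotC w). Qed.

Lemma dotZl a u v : dot (a *: u) v = a * dot u v.
Proof. by rewrite dotC dotZr dotC. Qed.

Lemma dotNl u v : dot (- u) v = - dot u v.
Proof. by rewrite dotC dotNr dotC. Qed.

Lemma dotBl u v w : dot (u - v) w = dot u w - dot v w.
Proof. by rewrite dotDl dotNl. Qed.

Lemma dot0r u : dot u 0 = 0.
Proof. by rewrite -[X in dot u X](scale0r (0 : 'cV[R]_n)) dotZr mul0r. Qed.

Lemma dot0l u : dot 0 u = 0.
Proof. by rewrite dotC dot0r. Qed.

Lemma dot_sumr (I : finType) u (F : I -> 'cV[R]_n) :
  dot u (\sum_i F i) = \sum_i dot u (F i).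
Proof. by apply: (big_morph (dot u)) => [v w|]; rewrite ?dotDr ?dot0r. Qed.

Lemma dot_suml (I : finType) u (F : I -> 'cV[R]_n) :
  dot (\sum_i F i) u = \sum_i dot (F i) u.
Proof. by rewrite dotC dot_sumr; apply: eq_bigr => i _; rewrite dotC. Qed.

Lemma dot_mulmx (A : 'M[R]_n) u v : dot (A *m u) v = dot u (A^T *m v).
Proof.
rewrite /dot; under eq_bigr do rewrite mxE mulr_suml.
rewrite exchange_big; apply: eq_bigr => i _.
by rewrite mxE mulr_sumr; apply: eq_bigr => j _; rewrite mxE mulrCA mulrA.
Qed.

Lemma dotE u v : u^T *m v = (dot u v)%:M.
Proof.
apply/matrixP => i j; rewrite !ord1 !mxE eqxx mulr1n.
by apply: eq_bigr => k _; rewrite mxE.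
Qed.

Lemma mul_outer u v w : u *m v^T *m w = dot v w *: u.
Proof. by rewrite -mulmxA dotE mul_mx_scalar. Qed.

Lemma dot_ge0 u : 0 <= dot u u.
Proof. by apply: sumr_ge0 => i _; rewrite -expr2 sqr_ge0. Qed.

Lemma sym_dot (S : 'M[R]_n) u v : S^T = S -> dot (S *m u) v = dot (S *m v) u.
Proof. by move=> sS; rewrite dot_mulmx sS dotC. Qed.

End Dot.

Section MatrixDifferentials.
Variables (R : realType) (V : normedModType R).
Implicit Types x : V.

Lemma is_diff_mulmx m n p (f df : V -> 'M[R]_(m, n)) (g dg : V -> 'M[R]_(n, p)) x :
  is_diff x f df -> is_diff x g dg ->
  is_diff x (fun y => f y *m g y) (fun v => df v *m g x + f x *m dg v).
Proof.
move=> hf hg; apply: is_diff_mx => i j.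
have -> : (fun y => (f y *m g y) i j) = (fun y => \sum_k f y i k * g y k j).
  by apply/funext => y; rewrite mxE.
apply: (@is_diff_ext _ _ _ _ (fun v => \sum_k (df v i k * g x k j + f x i k * dg v k j))).
  by apply: is_diff_sum => k; apply: is_diff_mul; exact: is_diff_coord.
by move=> v; rewrite !mxE -big_split.
Qed.

Lemma is_diff_scalemx m n (k dk : V -> R) (g dg : V -> 'M[R]_(m, n)) x :
  is_diff x k dk -> is_diff x g dg ->
  is_diff x (fun y => k y *: g y) (fun v => dk v *: g x + k x *: dg v).
Proof.
move=> hf hg; apply: is_diff_mx => i j.
have -> : (fun y => (k y *: g y) i j) = (fun y => k y * g y i j).
  by apply/funext => y; rewrite mxE.
apply: (@is_diff_ext _ _ _ _ (fun v => dk v * g x i j + k x * dg v i j)).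
  by apply: is_diff_mul => //; exact: is_diff_coord.
by move=> v; rewrite !mxE.
Qed.

Lemma is_diff_trmx m n (f df : V -> 'M[R]_(m, n)) x :
  is_diff x f df -> is_diff x (fun y => (f y)^T) (fun v => (df v)^T).
Proof.
move=> hf; apply: is_diff_mx => i j.
rewrite (_ : (fun y => _) = fun y => f y j i); last by apply/funext => y; rewrite mxE.
by apply: (is_diff_ext (is_diff_coord j i hf)) => v; rewrite mxE.
Qed.

Lemma is_diff_dot n (f df g dg : V -> 'cV[R]_n) x :
  is_diff x f df -> is_diff x g dg ->
  is_diff x (fun y => dot (f y) (g y)) (fun v => dot (df v) (g x) + dot (f x) (dg v)).
Proof.
move=> hf hg.
apply: (@is_diff_ext _ _ _ _
  (fun v => \sum_k (df v k 0 * g x k 0 + f x k 0 * dg v k 0))).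
  by apply: is_diff_sum => k; apply: is_diff_mul; exact: is_diff_coord.
by move=> v; rewrite big_split.
Qed.

Lemma is_diff_lin m n (A : 'M[R]_(m, n)) p (f df : V -> 'M[R]_(n, p)) x :
  is_diff x f df -> is_diff x (fun y => A *m f y) (fun v => A *m df v).
Proof.
move=> hf; apply: (is_diff_ext (is_diff_mulmx (is_diff_const A x) hf)) => v.
by rewrite mul0mx add0r.
Qed.

Lemma smooth_on_dot (U : set V) n (f g : V -> 'cV[R]_n) : open U ->
  smooth_on U f -> smooth_on U g -> smooth_on U (fun x => dot (f x) (g x)).
Proof.
move=> oU sf sg; apply: smooth_on_sum => // i.
by apply: smooth_on_mul => //; exact: smooth_on_coord.
Qed.

End MatrixDifferentials.

(** * Tangent spaces and the Nijenhuis tensor *)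

Section Tangent.
Variables (R : realType) (n : nat).
Implicit Types (A U : set 'cV[R]_n) (x u v : 'cV[R]_n).

(** Differentiate the composite with a curve of velocity [v]: it vanishes near 0. *)
Lemma tangent_image A x v (W : normedModType R) (U : set 'cV[R]_n)
    (f df : 'cV[R]_n -> W) :
  tangent A x v -> open U -> U x -> is_diff x f df ->
  (forall y, A y -> U y -> f y = 0) -> df v = 0.
Proof.
move=> [I [g [oI I0 sg gA [g0 gv]]]] oU Ux hf f0.
have dg : is_diff (0 : R) g (fun t => 'D_t g 0) by exact: smooth_on_is_diff sg I0.
rewrite -gv; have hf' : is_diff (g 0) f df by rewrite g0.
have h := is_diff_chain dg hf'.
have <- := is_diff_derive (1 : R) h; rewrite -[RHS](derive_cst (0 : W) (0 : R) (1 : R)).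
apply: near_eq_derive.
have gc : {for 0, continuous g} by apply/differentiable_continuous/(smooth_on_diff sg).
have nU : \forall t \near (0 : R), U (g t).
  by apply: gc; rewrite g0; exact: open_nbhs_nbhs.
have nI : \forall t \near (0 : R), I t by exact: open_nbhs_nbhs.
by near=> t; apply: f0; [apply: gA|]; near: t.
Unshelve. all: by end_near. Qed.

(** Tangent spaces cut out by the linear equations [dot (c k x) v = 0], where the
    covector fields [c k] have symmetric derivatives, as gradients have.  The
    symmetry is what makes the bracket of tangent fields tangent. *)
Definition conormal A (K : Type) (c : K -> 'cV[R]_n -> 'cV[R]_n) : Prop :=
  forall x, A x ->
    (forall v, tangent A x v <-> forall k, dot (c k x) v = 0) /\
    forall k, exists2 H : 'M[R]_n, H^T = H & is_diff x (c k) (mulmx H).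

Variables (A : set 'cV[R]_n) (K : Type) (c : K -> 'cV[R]_n -> 'cV[R]_n).
Hypothesis hc : conormal A c.

Lemma tangentP x v : A x -> tangent A x v <-> forall k, dot (c k x) v = 0.
Proof. by move=> /hc []. Qed.

Lemma tangentB x u v : A x ->
  tangent A x u -> tangent A x v -> tangent A x (u - v).
Proof.
move=> Ax /(tangentP _ Ax) hu /(tangentP _ Ax) hv; apply/(tangentP _ Ax) => k.
by rewrite dotBr hu hv subr0.
Qed.

Section Brackets.
Variables (U : set 'cV[R]_n) (x : 'cV[R]_n).
Hypotheses (oU : open U) (Ax : A x) (Ux : U x).

Definition tangent_field (X : 'cV[R]_n -> 'cV[R]_n) :=
  differentiable X x /\ forall y, A y -> U y -> tangent A y (X y).

(** Differentiating [dot (c k) Y = 0] along [X] and [dot (c k) X = 0] along [Y]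
    and subtracting, the terms with the derivative of [c k] cancel by symmetry. *)
Lemma tangent_lie_bracket X Y :
  tangent_field X -> tangent_field Y -> tangent A x (lie_bracket X Y x).
Proof.
move=> [dX tX] [dY tY]; apply/(tangentP _ Ax) => k.
have [_ /(_ k)[H symH dc]] := hc Ax.
have hX : is_diff x X ('d X x) by exact: differentiableP.
have hY : is_diff x Y ('d Y x) by exact: differentiableP.
have cX y : A y -> U y -> dot (c k y) (X y) = 0.
  by move=> Ay Uy; have /(tangentP _ Ay) h := tX y Ay Uy.
have cY y : A y -> U y -> dot (c k y) (Y y) = 0.
  by move=> Ay Uy; have /(tangentP _ Ay) h := tY y Ay Uy.
have /= e1 := tangent_image (tX x Ax Ux) oU Ux (is_diff_dot dc hY) cY.
have /= e2 := tangent_image (tY x Ax Ux) oU Ux (is_diff_dot dc hX) cX.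
rewrite /lie_bracket (is_diff_derive _ hX) (is_diff_derive _ hY) dotBr.
move: e1 e2; rewrite (sym_dot (X x) _ symH) => e1 e2.
by apply/eqP; rewrite subr_eq0; apply/eqP;
  apply: (addrI (dot (H *m Y x) (X x))); rewrite e1 e2.
Qed.

End Brackets.

Variable J : 'cV[R]_n -> 'M[R]_n.
Hypothesis J_diff : forall x, A x -> differentiable J x.
Hypothesis JT : forall x v, A x -> tangent A x v ->
  tangent A x (J x *m v) /\ J x *m (J x *m v) = - v.

(** The Nijenhuis tensor of the endomorphism field [J] for the flat connection of
    the ambient space, at the vectors [u] and [v]. *)
Definition nij_form x u v : 'cV[R]_n :=
  'D_(J x *m u) J x *m v - 'D_(J x *m v) J x *m u
  - J x *m ('D_u J x *m v - 'D_v J x *m u).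

(** Integrability tested on fields which are only differentiable at the point
    considered: such fields are stable under transport by a map without any
    discussion of higher derivatives. *)
Definition integrable_at_diff (B : set 'cV[R]_n) (JB : 'cV[R]_n -> 'M[R]_n) : Prop :=
  forall (U : set 'cV[R]_n) (J' : 'cV[R]_n -> 'M[R]_n)
    (X Y : 'cV[R]_n -> 'cV[R]_n) x,
  open U -> B x -> U x ->
  differentiable J' x -> differentiable X x -> differentiable Y x ->
  (forall y, B y -> U y ->
    [/\ J' y = JB y, tangent B y (X y) & tangent B y (Y y)]) ->
  nijenhuis J' X Y x = 0.

(** In the brackets, derivatives along tangent vectors may be computed with [J]
    in place of [J'].  The terms with derivatives of [X] and [Y] then add up to
    [- (J J + 1)] applied to the bracket of [X] and [Y], which is tangent. *)
Lemma nijenhuis_nij_form (U : set 'cV[R]_n) (J' : 'cV[R]_n -> 'M[R]_n) X Y x :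
  open U -> A x -> U x -> differentiable J' x ->
  (forall y, A y -> U y -> J' y = J y) ->
  tangent_field U x X -> tangent_field U x Y ->
  nijenhuis J' X Y x = nij_form x (X x) (Y x) /\
  tangent A x (nijenhuis J' X Y x).
Proof.
move=> oU Ax Ux dJ' J'J fX fY.
have hJ' : is_diff x J' ('d J' x) by exact: differentiableP.
have hJ : is_diff x J ('d J x) by apply: differentiableP; exact: J_diff.
have fJ Z : tangent_field U x Z -> tangent_field U x (fun y => J' y *m Z y).
  move=> [dZ tZ]; have hZ : is_diff x Z ('d Z x) by exact: differentiableP.
  split; first exact: is_diff_differentiable (is_diff_mulmx hJ' hZ).
  by move=> y Ay Uy; rewrite J'J //; apply (JT Ay (tZ y Ay Uy)).
have DJ Z w : tangent_field U x Z -> tangent A x w ->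
    'D_w (fun y => J' y *m Z y) x = 'D_w J x *m Z x + J x *m 'D_w Z x.
  move=> [dZ tZ] tw; have hZ : is_diff x Z ('d Z x) by exact: differentiableP.
  have h' := is_diff_mulmx hJ' hZ; have h := is_diff_mulmx hJ hZ.
  rewrite (is_diff_derive _ h') (is_diff_derive _ hJ) (is_diff_derive _ hZ).
  have hd := is_diff_add h' (is_diff_opp h).
  apply/eqP; rewrite -subr_eq0; apply/eqP; apply: (tangent_image tw oU Ux hd).
  by move=> y Ay Uy; rewrite J'J // subrr.
have tX : tangent A x (X x) by exact: fX.2.
have tY : tangent A x (Y x) by exact: fY.2.
have [tJX JJX] := JT Ax tX; have [tJY JJY] := JT Ax tY.
have tb := tangent_lie_bracket oU Ax Ux.
split; last first.
  rewrite /nijenhuis; apply: tangentB => //; last exact: tb.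
  apply: tangentB => //; last first.
    by rewrite J'J //; apply: (JT Ax _).1; apply: tb => //; exact: fJ.
  apply: tangentB => //; first by apply: tb; exact: fJ.
  by rewrite J'J //; apply: (JT Ax _).1; apply: tb => //; exact: fJ.
have [_ JJb] := JT Ax (tb _ _ fX fY).
rewrite /nijenhuis /lie_bracket J'J // !DJ // /nij_form.
move: JJb; rewrite /lie_bracket.
move: ('D_(X x) Y x) ('D_(Y x) X x) ('D_(J x *m X x) Y x) ('D_(J x *m Y x) X x).
move=> a b p q; rewrite !(mulmxBr, mulmxDr).
move: (J x *m (J x *m a)) (J x *m (J x *m b)) => JJa JJb /eqP.
rewrite subr_eq => /eqP ->.
move: ('D_(J x *m X x) J x *m Y x) ('D_(J x *m Y x) J x *m X x) => d1 d2.
move: (J x *m ('D_(X x) J x *m Y x)) (J x *m ('D_(Y x) J x *m X x)) => d3 d4.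
move: (J x *m p) (J x *m q) => Jp Jq.
by apply/matrixP => i j; rewrite !mxE; ring.
Qed.

(** The value of [nij_form] is known in advance to be tangent, so that it
    suffices to show that it vanishes modulo a complement of the tangent space. *)
Lemma integrable_of_nij_form :
  (forall x u v, A x -> tangent A x u -> tangent A x v ->
     tangent A x (nij_form x u v) -> nij_form x u v = 0) ->
  integrable_at_diff A J.
Proof.
move=> h U J' X Y x oU Ax Ux dJ' dX dY t.
have [| | |e tN] := @nijenhuis_nij_form U J' X Y x oU Ax Ux dJ'.
- by move=> y Ay Uy; have [] := t y Ay Uy.
- by split=> // y Ay Uy; have [] := t y Ay Uy.
- by split=> // y Ay Uy; have [] := t y Ay Uy.
have [_ tX tY] := t x Ax Ux.
by rewrite e; apply: h => //; rewrite -e.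
Qed.

End Tangent.

Lemma integrable_at_diffW (R : realType) n (A : set 'cV[R]_n) J :
  integrable_at_diff A J -> Defs.integrable A J.
Proof.
move=> h U J' X Y oU sJ sX sY t x Ax Ux.
by apply: (h U) => //; apply: smooth_on_diff; eassumption.
Qed.

(** * Composition and the symmetry of second derivatives *)

Section SmoothComp.
Variables (R : realType) (V : normedModType R) (n : nat).
Variables (U : set V) (W : set 'cV[R]_n) (g : V -> 'cV[R]_n).
Hypotheses (oU : open U) (oW : open W) (sg : smooth_on U g).
Hypothesis gUW : forall x, U x -> W (g x).

(** Closed under derivation by the chain rule written with partial derivatives. *)
Inductive comp_alg : (V -> R) -> Prop :=
| comp_alg_base f : smooth_on U f -> comp_alg f
| comp_alg_comp (f : 'cV[R]_n -> R) : smooth_on W f -> comp_alg (fun x => f (g x))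
| comp_alg_add f h : comp_alg f -> comp_alg h -> comp_alg (fun x => f x + h x)
| comp_alg_mul f h : comp_alg f -> comp_alg h -> comp_alg (fun x => f x * h x).

Lemma cV_delta (v : 'cV[R]_n) : v = \sum_i v i 0 *: delta_mx i 0.
Proof.
rewrite {1}[v]matrix_sum_delta; apply: eq_bigr => i _.
by rewrite big_ord1.
Qed.

Lemma smooth_on_comp_scalar (f : 'cV[R]_n -> R) :
  smooth_on W f -> smooth_on U (fun x => f (g x)).
Proof.
move=> sf; suff h : forall f, comp_alg f -> smooth_on U f by apply: h; exact: comp_alg_comp.
move=> {sf}f; apply: (smooth_on_coind oU) => {}f sf.
suff [df df_ hdf] : exists2 df : V -> V -> R,
    (forall x, U x -> is_diff x f (fun v => df v x)) &
    forall v, comp_alg (df v).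
  split=> [x Ux|v]; first exact: (is_diff_differentiable (df_ x Ux)).
  by exists (df v) => // x Ux; rewrite (is_diff_derive v (df_ x Ux)).
elim: sf => {f}.
- move=> f sf; exists (fun v x => 'D_v f x) => [x|v]; first exact: smooth_on_is_diff.
  by constructor; exact: smooth_on_D.
- move=> f sf; exists (fun v x => \sum_i 'D_v g x i 0 * 'D_(delta_mx i 0) f (g x)).
    move=> x Ux; have hf := smooth_on_is_diff sf (gUW Ux).
    apply: (is_diff_ext (is_diff_chain (smooth_on_is_diff sg Ux) hf)) => v.
    rewrite (deriveE _ (is_diff_differentiable hf)) [X in 'd f _ X]cV_delta linear_sum.
    apply: eq_bigr => i _.
    by rewrite linearZ (deriveE _ (is_diff_differentiable hf)).
  move=> v; rewrite (_ : (fun x => _) =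
    \sum_i (fun x => 'D_v g x i 0 * 'D_(delta_mx i 0) f (g x))); last first.
    by apply/funext => x; rewrite fct_sumE.
  apply: big_ind => [||i _]; [|exact: comp_alg_add|].
    by constructor; exact: smooth_on_const.
  apply: comp_alg_mul; last first.
    by apply: (@comp_alg_comp (fun y => 'D_(delta_mx i 0) f y)); exact: smooth_on_D.
  by constructor; apply: smooth_on_coord => //; exact: smooth_on_D.
- move=> f h sf [df hf sdf] sh [dh hh sdh].
  exists (fun v x => df v x + dh v x) => [x Ux|v]; last exact: comp_alg_add.
  exact: is_diff_add (hf x Ux) (hh x Ux).
- move=> f h sf [df hf sdf] sh [dh hh sdh].
  exists (fun v x => df v x * h x + f x * dh v x) => [x Ux|v].
    exact: is_diff_mul (hf x Ux) (hh x Ux).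
  by apply: comp_alg_add; apply: comp_alg_mul.
Qed.

Lemma smooth_on_comp p q (f : 'cV[R]_n -> 'M[R]_(p, q)) :
  smooth_on W f -> smooth_on U (fun x => f (g x)).
Proof.
move=> sf; apply: smooth_on_mx => // i j.
by apply: (@smooth_on_comp_scalar (fun y => f y i j)); exact: smooth_on_coord.
Qed.

End SmoothComp.

Section Schwarz.
Variables (R : realType) (V : normedModType R) (f : V -> R).
Hypothesis sf : smooth_on setT f.

Lemma is_diff_line x u (t : R) (g : V -> R) : smooth_on setT g ->
  is_derive t (1 : R) (fun s : R => g (x + s *: u)) ('D_u g (x + t *: u)).
Proof.
move=> sg.
have h1 : is_diff t (fun s : R => x + s *: u) (fun s : R => s *: u).
  apply: (is_diff_ext (is_diff_add (is_diff_const x t) (is_diff_scalel t u))) => s.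
  by rewrite add0r.
have h2 : is_diff (x + t *: u) g (fun v => 'D_v g (x + t *: u)).
  exact: smooth_on_is_diff.
have h := is_diff_chain h1 h2.
apply: DeriveDef; first by apply: diff_derivable; exact: is_diff_differentiable h.
by rewrite (is_diff_derive _ h) scale1r.
Qed.

(** The mean value theorem is applied in the direction [u] to the increment of
    [f] along [v], then in the direction [v] to the derivative. *)
Lemma second_difference x u v (h : R) : 0 < h ->
  exists s t : R, [/\ 0 < s < h, 0 < t < h &
    f (x + h *: u + h *: v) - f (x + h *: u) - f (x + h *: v) + f x =
    h ^+ 2 * 'D_v (fun y => 'D_u f y) (x + s *: u + t *: v)].
Proof.
move=> h0.
pose phi (s : R) := f ((x + h *: v) + s *: u) - f (x + s *: u).
have dphi (s : R) : is_derive s (1 : R) phi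
    ('D_u f ((x + h *: v) + s *: u) - 'D_u f (x + s *: u)).
  by apply: is_deriveB; exact: is_diff_line.
have cont (g : R -> R) (dg : R -> R) : (forall s : R, is_derive s (1 : R) g (dg s)) ->
    exists2 s : R, 0 < s < h & g h - g 0 = dg s * h.
  move=> hg; have gc : {within `[0, h], continuous g}.
    by apply: derivable_within_continuous => s _; have [] := hg s.
  have [s hs e] := MVT h0 (fun s _ => hg s) gc.
  by exists s; [move: hs; rewrite in_itv|rewrite e subr0].
have [s hs e] := cont _ _ dphi.
pose psi (t : R) := 'D_u f (x + s *: u + t *: v).
have [|t ht e'] := cont psi (fun t => 'D_v (fun y => 'D_u f y) (x + s *: u + t *: v)).
  by move=> t; apply: is_diff_line; exact: smooth_on_D.
exists s, t; split=> //.
move: e e'; rewrite /phi /psi !scale0r !addr0 [x + h *: v + s *: u]addrAC => e e'.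
rewrite expr2 mulrAC -mulrA [h * (_ * _)]mulrC -e' -e [x + h *: v + h *: u]addrAC.
ring.
Qed.

Lemma eq_at_limit (a b : V -> R) x u v :
  {for x, continuous a} -> {for x, continuous b} ->
  (forall h : R, 0 < h -> exists s t s' t' : R,
     [/\ 0 < s < h, 0 < t < h, 0 < s' < h, 0 < t' < h &
      a (x + s *: u + t *: v) = b (x + s' *: u + t' *: v)]) ->
  a x = b x.
Proof.
move=> ca cb hab.
apply/eqP; rewrite -subr_eq0 -normr_le0; apply/ler_addgt0Pr => e e0; rewrite add0r.
have [d /= d0 hd] : exists2 d : R, 0 < d & forall y, `|x - y| < d ->
    `|a x - a y| < e / 2 /\ `|b x - b y| < e / 2.
  have e2 : 0 < e / 2 by rewrite divr_gt0.
  have /cvgrPdist_lt /(_ _ e2) na := ca.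
  have /cvgrPdist_lt /(_ _ e2) nb := cb.
  have /nbhs_normP[d d0 hd] :
      \forall y \near x, `|a x - a y| < e / 2 /\ `|b x - b y| < e / 2.
    exact: filterI na nb.
  by exists d.
(* The summand 1 keeps the denominator positive when both vectors vanish. *)
pose h := d / (`|u| + `|v| + 1).
have n0 : 0 < `|u| + `|v| + 1 by rewrite ltr_wpDl ?addr_ge0.
have h0 : 0 < h by rewrite divr_gt0.
have hin (s t : R) : 0 < s < h -> 0 < t < h -> `|x - (x + s *: u + t *: v)| < d.
  move=> /andP[s0 sh] /andP[t0 th].
  rewrite -addrA opprD addrA subrr sub0r normrN.
  apply: (le_lt_trans (ler_normD _ _)); rewrite !normrZ !gtr0_norm //.
  apply: (@le_lt_trans _ _ (h * (`|u| + `|v|))).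
    by rewrite mulrDr lerD // ler_wpM2r // ltW.
  by rewrite /h mulrAC ltr_pdivrMr // ltr_pM2l // ltrDl.
have [s [t [s' [t' [hs ht hs' ht' e1]]]]] := hab h h0.
have [l1 _] := hd _ (hin s t hs ht); have [_ l2] := hd _ (hin s' t' hs' ht').
rewrite -(subrKA (a (x + s *: u + t *: v))).
apply: (le_trans (ler_normD _ _)); rewrite [e]splitr lerD ?ltW //.
by rewrite e1 distrC.
Qed.

(** The second difference is symmetric in [u] and [v], so both mixed derivatives
    agree at points arbitrarily close to [x], and both are continuous. *)
Lemma schwarz x u v :
  'D_v (fun y => 'D_u f y) x = 'D_u (fun y => 'D_v f y) x.
Proof.
apply: (@eq_at_limit (fun y => 'D_v (fun y => 'D_u f y) y)
                     (fun y => 'D_u (fun y => 'D_v f y) y) x u v).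
- by apply/differentiable_continuous/(@smooth_on_diff _ _ setT) => //;
    exact/smooth_on_D/smooth_on_D.
- by apply/differentiable_continuous/(@smooth_on_diff _ _ setT) => //;
    exact/smooth_on_D/smooth_on_D.
move=> h h0.
have [s [t [hs ht e1]]] := second_difference x u v h0.
have [t' [s' [ht' hs' e2]]] := second_difference x v u h0.
rewrite [x + t' *: v + _]addrAC [x + h *: v + _]addrAC in e2.
have h2 : h ^+ 2 != 0 by rewrite expf_neq0 // gt_eqF.
exists s, t, s', t'; split; [exact: hs|exact: ht|exact: hs'|exact: ht'|].
apply: (mulfI h2); apply: (etrans (esym e1)); apply: etrans e2.
by congr (_ + _); exact: addrAC.
Qed.

End Schwarz.

(** * Transport of complex structures by diffeomorphisms *)

Section Jacobian.
Variables (R : realType) (n q : nat).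
Implicit Types (f : 'cV[R]_n -> 'cV[R]_q) (x u v : 'cV[R]_n).

Definition jac f x : 'M[R]_(q, n) := \matrix_(i, j) 'D_(delta_mx j 0) f x i 0.

Lemma jacE f x v : differentiable f x -> jac f x *m v = 'D_v f x.
Proof.
move=> df; rewrite (deriveE _ df) {2}[v]cV_delta linear_sum.
apply/colP => i; rewrite !mxE summxE; apply: eq_bigr => j _.
by rewrite linearZ mxE -(deriveE _ df) !mxE mulrC.
Qed.

Lemma is_diff_jac f x : differentiable f x -> is_diff x f (mulmx (jac f x)).
Proof.
move=> df; apply: (is_diff_ext (differentiableP df)) => v.
by rewrite jacE ?deriveE.
Qed.

Lemma smooth_on_jac f : smooth_on setT f -> smooth_on setT (jac f).
Proof.
move=> sf; apply: smooth_on_mx => [|i j]; first exact: openT.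
rewrite (_ : (fun x => _) = fun x => 'D_(delta_mx j 0) f x i 0).
  by apply: smooth_on_coord; [exact: openT|exact: smooth_on_D].
by apply/funext => x; rewrite mxE.
Qed.

Lemma derive_jac_sym f x u v : smooth_on setT f ->
  'D_u (jac f) x *m v = 'D_v (jac f) x *m u.
Proof.
move=> sf; have oT := @openT 'cV[R]_n.
have e w w' : 'D_w (jac f) x *m w' = 'D_w (fun y => 'D_w' f y) x.
  have hj := smooth_on_is_diff (smooth_on_jac sf) (I : setT x).
  have h := is_diff_mulmx hj (is_diff_const w' x).
  have -> : (fun y => 'D_w' f y) = (fun y => jac f y *m w').
    by apply/funext => y; rewrite jacE //; exact: (smooth_on_diff sf).
  by rewrite (is_diff_derive _ h) mulmx0 addr0.
apply: (etrans (e u v)); apply: (etrans _ (esym (e v u))).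
apply/colP => i.
have c w w' : 'D_w (fun y => 'D_w' f y) x i 0 =
    'D_w (fun y => 'D_w' (fun z => f z i 0) y) x.
  have h := is_diff_coord i 0 (smooth_on_is_diff (smooth_on_D w' sf) (I : setT x)).
  rewrite -(is_diff_derive w h); congr ('D_w _ x); apply/funext => y.
  by rewrite -(is_diff_derive _ (is_diff_coord i 0 (smooth_on_is_diff sf (I : setT y)))).
apply: (etrans (c u v)); apply: (etrans _ (esym (c v u))).
by apply: schwarz; exact: smooth_on_coord.
Qed.

(** The image of a curve is a curve. *)
Lemma tangent_map (A : set 'cV[R]_n) (B : set 'cV[R]_q) f x v :
  smooth_on setT f -> (forall y, A y -> B (f y)) ->
  tangent A x v -> tangent B (f x) (jac f x *m v).
Proof.
move=> sf fAB [I [g [oI I0 sg gA [g0 gv]]]].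
exists I, (fun t => f (g t)); split=> //.
- by apply: (smooth_on_comp oI (@openT _) sg).
- by move=> t /gA /fAB.
- split; first by rewrite g0.
  have hg := smooth_on_is_diff sg I0.
  have hf := is_diff_jac (smooth_on_diff sf (Logic.I : setT (g 0))).
  by rewrite (is_diff_derive _ (is_diff_chain hg hf)) g0 gv.
Qed.

End Jacobian.

Lemma subr_addl_cancel (M : zmodType) (a b c d : M) :
  a = c -> a + b - (c + d) = b - d.
Proof. by move=> ->; rewrite opprD addrACA subrr add0r. Qed.

Section Transport.
Variables (R : realType) (n q : nat) (A : set 'cV[R]_n) (B : set 'cV[R]_q).
Variables (f : 'cV[R]_n -> 'cV[R]_q) (g : 'cV[R]_q -> 'cV[R]_n).
Hypotheses (sf : smooth_on setT f) (sg : smooth_on setT g).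
Hypotheses (fAB : forall x, A x -> B (f x)) (fK : forall x, A x -> g (f x) = x).
Hypotheses (gBA : forall y, B y -> A (g y)) (gK : forall y, B y -> f (g y) = y).
Variables (K : Type) (c : K -> 'cV[R]_q -> 'cV[R]_q).
Hypothesis hc : conormal B c.
Variable JB : 'cV[R]_q -> 'M[R]_q.
Hypothesis sJ : smooth_on setT JB.
Hypothesis JBT : forall x v, B x -> tangent B x v ->
  tangent B x (JB x *m v) /\ JB x *m (JB x *m v) = - v.
Hypothesis JBI : integrable_at_diff B JB.

Let F x := jac f x.
Let G x := jac g (f x).
(** The conjugate of [JB] by the differential of [f]; the inverse of that
    differential on tangent vectors is the differential of [g]. *)
Definition pull_J x := G x *m JB (f x) *m F x.

Let df x : differentiable f x. Proof. exact: (smooth_on_diff sf). Qed.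
Let dg x : differentiable g x. Proof. exact: (smooth_on_diff sg). Qed.

Lemma jac_left_inv x v : A x -> tangent A x v -> G x *m (F x *m v) = v.
Proof.
move=> Ax tv; apply/eqP; rewrite -subr_eq0; apply/eqP.
have h := is_diff_chain (is_diff_jac (df x)) (is_diff_jac (dg (f x))).
apply: (tangent_image tv (@openT _) Logic.I (is_diff_add h (is_diff_opp (is_diff_id x)))).
by move=> y Ay _; rewrite fK // subrr.
Qed.

Lemma jac_right_inv x v : A x -> tangent B (f x) v -> F x *m (G x *m v) = v.
Proof.
move=> Ax tv; apply/eqP; rewrite -subr_eq0; apply/eqP.
have hf := is_diff_jac (df (g (f x))); rewrite fK // in hf.
have hg := is_diff_jac (dg (f x)).
have hf' : is_diff (g (f x)) f (mulmx (F x)) by rewrite fK.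
have h := is_diff_chain hg hf'.
apply: (tangent_image tv (@openT _) Logic.I (is_diff_add h (is_diff_opp (is_diff_id _)))).
by move=> y By _; rewrite gK // subrr.
Qed.

Lemma tangent_push x v : tangent A x v -> tangent B (f x) (F x *m v).
Proof. exact: tangent_map. Qed.

Lemma tangent_pull x v : A x -> tangent B (f x) v -> tangent A x (G x *m v).
Proof. by move=> Ax tv; rewrite -{1}(fK Ax); exact: (tangent_map sg gBA). Qed.

Lemma pull_J_complex x v : A x -> tangent A x v ->
  tangent A x (pull_J x *m v) /\ pull_J x *m (pull_J x *m v) = - v.
Proof.
move=> Ax tv; have [t JJ] := JBT (fAB Ax) (tangent_push tv).
rewrite /pull_J -!mulmxA; split; first exact: tangent_pull.
by rewrite jac_right_inv // JJ !mulmxN jac_left_inv.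
Qed.

Lemma smooth_pull_J : smooth_on setT pull_J.
Proof.
have oT := @openT 'cV[R]_n.
apply: smooth_on_mulmx => //; last exact: smooth_on_jac.
by apply: smooth_on_mulmx => //; apply: (smooth_on_comp oT (@openT _) sf) => //;
  exact: smooth_on_jac.
Qed.

Let push (X : 'cV[R]_n -> 'cV[R]_n) (w : 'cV[R]_q) : 'cV[R]_q :=
  F (g w) *m X (g w).

(** On [A] the push-forward of [X] composed with [f] is [F X], and only the values
    on [A] matter along tangent vectors. *)
Lemma derive_push X U x u : open U -> A x -> U x -> tangent_field A U x X ->
  tangent A x u ->
  'D_(F x *m u) (push X) (f x) = 'D_u F x *m X x + F x *m 'D_u X x.
Proof.
move=> oU Ax Ux [dX tX] tu.
have hX : is_diff x X ('d X x) := differentiableP dX.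
have hF : is_diff x F (fun v => 'D_v F x).
  exact: (smooth_on_is_diff (smooth_on_jac sf)).
have hFX := is_diff_mulmx hF hX.
have hFXg : is_diff (g (f x)) (fun y => F y *m X y)
   (fun v => 'D_v F x *m X x + F x *m 'd X x v) by rewrite fK.
have hp := is_diff_chain (is_diff_jac (dg (f x))) hFXg.
have hpf := is_diff_chain (is_diff_jac (df x)) hp.
rewrite (is_diff_derive _ hp) (is_diff_derive _ hX).
apply/eqP; rewrite -subr_eq0; apply/eqP.
apply: (tangent_image tu oU Ux (is_diff_add hpf (is_diff_opp hFX))).
by move=> y Ay Uy; rewrite fK // subrr.
Qed.

Lemma push_field X U x : open U -> A x -> U x -> tangent_field A U x X ->
  tangent_field B (g @^-1` U) (f x) (push X).
Proof.
move=> oU Ax Ux [dX tX]; split.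
  have dX' : differentiable X (g (f x)) by rewrite fK.
  have hX := differentiableP dX'.
  have hF : is_diff (g (f x)) F (fun v => 'D_v F (g (f x))).
    exact: (smooth_on_is_diff (smooth_on_jac sf)).
  exact: is_diff_differentiable (is_diff_chain (is_diff_jac (dg (f x))) (is_diff_mulmx hF hX)).
move=> w Bw Uw; have := tangent_push (tX _ (gBA Bw) Uw).
by rewrite gK.
Qed.

(** The terms with the derivative of the Jacobian matrix cancel, because second
    derivatives of [f] are symmetric. *)
Lemma lie_bracket_push X Y U x : open U -> A x -> U x ->
  tangent_field A U x X -> tangent_field A U x Y ->
  lie_bracket (push X) (push Y) (f x) = F x *m lie_bracket X Y x.
Proof.
move=> oU Ax Ux fX fY.
have pE Z : push Z (f x) = F x *m Z x by rewrite /push fK.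
have tX : tangent A x (X x) by exact: fX.2.
have tY : tangent A x (Y x) by exact: fY.2.
rewrite /lie_bracket (pE X) (pE Y).
rewrite (derive_push oU Ax Ux fY tX) (derive_push oU Ax Ux fX tY).
rewrite mulmxBr; apply: subr_addl_cancel; exact: derive_jac_sym.
Qed.

(** Tangent fields are fixed by the differential of the retraction [g \o f].
    Differentiating this, and using the symmetry of its second derivatives, so
    is their bracket; this replaces a description of the tangent spaces of [A] by
    equations. *)
Lemma lie_bracket_retract X Y U x : open U -> A x -> U x ->
  tangent_field A U x X -> tangent_field A U x Y ->
  G x *m (F x *m lie_bracket X Y x) = lie_bracket X Y x.
Proof.
move=> oU Ax Ux fX fY.
pose r y := g (f y).
have sr : smooth_on setT r by apply: (smooth_on_comp (@openT _) (@openT _) sf).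
have er y (v : 'cV[R]_n) : jac r y *m v = G y *m (F y *m v).
  have h : is_diff y r (fun v => G y *m (F y *m v)).
    exact: is_diff_chain (is_diff_jac (df y)) (is_diff_jac (dg (f y))).
  by rewrite -(is_diff_derive v h) jacE //; exact: (smooth_on_diff sr).
have fix_D (Y0 : 'cV[R]_n -> 'cV[R]_n) u : tangent_field A U x Y0 -> tangent A x u ->
    'D_u (jac r) x *m Y0 x + jac r x *m 'D_u Y0 x = 'D_u Y0 x.
  move=> [dY tY] tu; have hY := differentiableP dY.
  have hj := smooth_on_is_diff (smooth_on_jac sr) (Logic.I : setT x).
  have h := is_diff_mulmx hj hY.
  rewrite (is_diff_derive _ hY).
  apply/eqP; rewrite -subr_eq0; apply/eqP.
  apply: (tangent_image tu oU Ux (is_diff_add h (is_diff_opp hY))).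
  by move=> y Ay Uy; rewrite er jac_left_inv ?subrr //; exact: tY.
rewrite -er /lie_bracket mulmxBr.
have e := derive_jac_sym x (X x) (Y x) sr.
apply: (etrans (esym (subr_addl_cancel _ _ e))).
exact: (congr2 (fun a b => a - b) (fix_D Y (X x) fY (fX.2 x Ax Ux))
                                  (fix_D X (Y x) fX (fY.2 x Ax Ux))).
Qed.

Lemma lie_bracket_ext (X X' Y Y' : 'cV[R]_q -> 'cV[R]_q) U z :
  open U -> B z -> U z ->
  tangent_field B U z X -> tangent_field B U z Y ->
  tangent_field B U z X' -> tangent_field B U z Y' ->
  (forall w, B w -> U w -> X w = X' w) ->
  (forall w, B w -> U w -> Y w = Y' w) ->
  lie_bracket X Y z = lie_bracket X' Y' z.
Proof.
move=> oU Bz Uz fX fY fX' fY' eX eY.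
have D Z Z' u u' : tangent_field B U z Z -> tangent_field B U z Z' ->
    (forall w, B w -> U w -> Z w = Z' w) -> u = u' -> tangent B z u ->
    'D_u Z z = 'D_u' Z' z.
  move=> [dZ _] [dZ' _] e <- tu.
  have hZ := differentiableP dZ; have hZ' := differentiableP dZ'.
  rewrite (is_diff_derive _ hZ) (is_diff_derive _ hZ').
  apply/eqP; rewrite -subr_eq0; apply/eqP.
  apply: (tangent_image tu oU Uz (is_diff_add hZ (is_diff_opp hZ'))).
  by move=> w Bw Uw; rewrite e ?subrr.
apply: (congr2 (fun a b => a - b)).
  by apply: D fY fY' eY (eX z Bz Uz) (fX.2 z Bz Uz).
by apply: D fX fX' eX (eY z Bz Uz) (fY.2 z Bz Uz).
Qed.

(** The differential of [f] sends the Nijenhuis tensor of [pull_J] to that of [JB]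
    on the pushed fields, which is zero, and it is injective on the combinations
    of brackets involved, by [lie_bracket_retract]. *)
Lemma pull_J_integrable : integrable_at_diff A pull_J.
Proof.
move=> U J' X Y x oU Ax Ux dJ' dX dY hU.
have fX : tangent_field A U x X by split=> // y Ay Uy; have [] := hU y Ay Uy.
have fY : tangent_field A U x Y by split=> // y Ay Uy; have [] := hU y Ay Uy.
have J'E y : A y -> U y -> J' y = pull_J y by move=> Ay Uy; have [] := hU y Ay Uy.
have fJ Z : tangent_field A U x Z -> tangent_field A U x (fun y => J' y *m Z y).
  move=> [dZ tZ]; split.
    exact: is_diff_differentiable (is_diff_mulmx (differentiableP dJ') (differentiableP dZ)).
  by move=> y Ay Uy; rewrite J'E //; apply: (pull_J_complex Ay (tZ y Ay Uy)).1.
pose W : set 'cV[R]_q := g @^-1` U.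
have oW : open W.
  by apply: open_comp => // z _; apply: differentiable_continuous; exact: dg.
have Bz := fAB Ax; have Wz : W (f x) by rewrite /W /= fK.
have fp Z : tangent_field A U x Z -> tangent_field B W (f x) (push Z) by exact: push_field.
have fJp Z : tangent_field A U x Z ->
    tangent_field B W (f x) (fun w => JB w *m push Z w).
  move=> /fp [dZ tZ]; split; last by move=> w Bw Ww; apply: (JBT Bw (tZ w Bw Ww)).1.
  have dJB : differentiable JB (f x) by exact: (smooth_on_diff sJ).
  exact: is_diff_differentiable (is_diff_mulmx (differentiableP dJB) (differentiableP dZ)).
have eJ Z : tangent_field A U x Z -> forall w, B w -> W w ->
    JB w *m push Z w = push (fun y => J' y *m Z y) w.
  move=> [dZ tZ] w Bw Ww; rewrite /push J'E //; last exact: gBA.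
  rewrite /pull_J gK // -!mulmxA -/(G _).
  have tp := tangent_push (tZ _ (gBA Bw) Ww); rewrite gK // in tp.
  have := @jac_right_inv (g w); rewrite gK // => ->//; first exact: gBA.
  by apply: (JBT Bw tp).1.
have lp X1 Y1 : tangent_field A U x X1 -> tangent_field A U x Y1 ->
    F x *m lie_bracket X1 Y1 x = lie_bracket (push X1) (push Y1) (f x).
  by move=> f1 f2; rewrite (lie_bracket_push oU).
have lt X1 Y1 : tangent_field A U x X1 -> tangent_field A U x Y1 ->
    tangent A x (lie_bracket X1 Y1 x).
  move=> f1 f2; rewrite -(lie_bracket_retract oU Ax Ux f1 f2).
  apply: tangent_pull => //; rewrite lp //.
  exact: (tangent_lie_bracket hc oW Bz Wz (fp _ f1) (fp _ f2)).
have FJ v : tangent A x v -> F x *m (J' x *m v) = JB (f x) *m (F x *m v).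
  move=> tv; rewrite J'E // /pull_J -!mulmxA jac_right_inv //.
  exact: (JBT Bz (tangent_push tv)).1.
have GF X1 Y1 : tangent_field A U x X1 -> tangent_field A U x Y1 ->
    G x *m (F x *m lie_bracket X1 Y1 x) = lie_bracket X1 Y1 x.
  exact: lie_bracket_retract.
have GFJ X1 Y1 : tangent_field A U x X1 -> tangent_field A U x Y1 ->
    G x *m (F x *m (J' x *m lie_bracket X1 Y1 x)) = J' x *m lie_bracket X1 Y1 x.
  move=> f1 f2; apply: jac_left_inv => //; rewrite J'E //.
  exact: (pull_J_complex Ax (lt _ _ f1 f2)).1.
have fJX := fJ _ fX; have fJY := fJ _ fY.
have GF_comb a b c' d : G x *m (F x *m a) = a -> G x *m (F x *m (J' x *m b)) = J' x *m b ->
    G x *m (F x *m (J' x *m c')) = J' x *m c' -> G x *m (F x *m d) = d ->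
    F x *m (a - J' x *m b - J' x *m c' - d) = 0 ->
    a - J' x *m b - J' x *m c' - d = 0 :> 'cV[R]_n.
  move=> e1 e2 e3 e4 e5; rewrite -{1}e1 -e2 -e3 -{1}e4.
  by rewrite -!mulmxBr e5 mulmx0.
apply: GF_comb; [exact: GF|exact: GFJ|exact: GFJ|exact: GF|].
have F_comb a b c' d a2 b2 c2 d2 : F x *m a = a2 ->
    F x *m (J' x *m b) = JB (f x) *m b2 ->
    F x *m (J' x *m c') = JB (f x) *m c2 -> F x *m d = d2 ->
    a2 - JB (f x) *m b2 - JB (f x) *m c2 - d2 = 0 ->
    F x *m (a - J' x *m b - J' x *m c' - d) = 0 :> 'cV[R]_q.
  by move=> e1 e2 e3 e4 <-; rewrite !mulmxBr e1 e2 e3 e4.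
have lpJ X1 Y1 X2 Y2 : tangent_field A U x X1 -> tangent_field A U x Y1 ->
    tangent_field B W (f x) X2 -> tangent_field B W (f x) Y2 ->
    (forall w, B w -> W w -> X2 w = push X1 w) ->
    (forall w, B w -> W w -> Y2 w = push Y1 w) ->
    F x *m lie_bracket X1 Y1 x = lie_bracket X2 Y2 (f x).
  move=> f1 f2 f3 f4 e1 e2; rewrite (lp _ _ f1 f2).
  by apply/esym; apply: (lie_bracket_ext oW Bz Wz f3 f4 (fp _ f1) (fp _ f2) e1 e2).
have N0 : nijenhuis JB (push X) (push Y) (f x) = 0.
  apply: (JBI oW Bz Wz (smooth_on_diff sJ _) (fp _ fX).1 (fp _ fY).1) => //.
  by move=> w Bw Ww; split=> //; [exact: (fp _ fX).2|exact: (fp _ fY).2].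
apply: F_comb N0.
- exact: (lpJ _ _ _ _ fJX fJY (fJp _ fX) (fJp _ fY) (eJ _ fX) (eJ _ fY)).
- rewrite FJ; last exact: lt; congr (_ *m _).
  exact: (lpJ _ _ _ _ fJX fY (fJp _ fX) (fp _ fY) (eJ _ fX)).
- rewrite FJ; last exact: lt; congr (_ *m _).
  exact: (lpJ _ _ _ _ fX fJY (fp _ fX) (fJp _ fY) _ (eJ _ fY)).
- exact: (lpJ _ _ _ _ fX fY (fp _ fX) (fp _ fY)).
Qed.

End Transport.

(** * Products *)

Section Product.
Variables (R : realType) (n p : nat).

Lemma is_diff_usubmx (z : 'cV[R]_(n + p)) :
  is_diff z (usubmx : 'cV[R]_(n + p) -> 'cV[R]_n) usubmx.
Proof.
apply: is_diff_mx => i j.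
rewrite (_ : (fun y : 'cV[R]_(n + p) => _) = fun y => y (lshift p i) j); last first.
  by apply/funext => y; rewrite mxE.
exact: (is_diff_coord _ _ (is_diff_id z)).
Qed.

Lemma is_diff_dsubmx (z : 'cV[R]_(n + p)) :
  is_diff z (dsubmx : 'cV[R]_(n + p) -> 'cV[R]_p) dsubmx.
Proof.
apply: is_diff_mx => i j.
rewrite (_ : (fun y : 'cV[R]_(n + p) => _) = fun y => y (rshift n i) j); last first.
  by apply/funext => y; rewrite mxE.
exact: (is_diff_coord _ _ (is_diff_id z)).
Qed.

Lemma smooth_on_usubmx (U : set 'cV[R]_(n + p)) : open U ->
  smooth_on U (usubmx : 'cV[R]_(n + p) -> 'cV[R]_n).
Proof. by move=> oU; apply: (smooth_on_affine oU is_diff_usubmx). Qed.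

Lemma smooth_on_dsubmx (U : set 'cV[R]_(n + p)) : open U ->
  smooth_on U (dsubmx : 'cV[R]_(n + p) -> 'cV[R]_p).
Proof. by move=> oU; apply: (smooth_on_affine oU is_diff_dsubmx). Qed.

Lemma dot_col_mx (a b : 'cV[R]_n) (c d : 'cV[R]_p) :
  dot (col_mx a c) (col_mx b d) = dot a b + dot c d.
Proof.
rewrite /dot big_split_ord; congr (_ + _); apply: eq_bigr => i _.
  by rewrite !col_mxEu.
by rewrite !col_mxEd.
Qed.

Section Fun.
Variables (V : normedModType R) (m : nat).

Lemma is_diff_col_mx (f df : V -> 'M[R]_(n, m)) (g dg : V -> 'M[R]_(p, m)) x :
  is_diff x f df -> is_diff x g dg ->
  is_diff x (fun y => col_mx (f y) (g y)) (fun v => col_mx (df v) (dg v)).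
Proof.
move=> hf hg; apply: is_diff_mx => i j; rewrite -[i](fintype.splitK i).
case: (fintype.split i) => k /=.
- rewrite (_ : (fun y => _) = fun y => f y k j); last first.
    by apply/funext => y; rewrite col_mxEu.
  by apply: (is_diff_ext (is_diff_coord _ _ hf)) => v; rewrite col_mxEu.
- rewrite (_ : (fun y => _) = fun y => g y k j); last first.
    by apply/funext => y; rewrite col_mxEd.
  by apply: (is_diff_ext (is_diff_coord _ _ hg)) => v; rewrite col_mxEd.
Qed.

Lemma smooth_on_col_mx (U : set V) (f : V -> 'M[R]_(n, m)) (g : V -> 'M[R]_(p, m)) :
  open U -> smooth_on U f -> smooth_on U g ->
  smooth_on U (fun y => col_mx (f y) (g y)).
Proof.
move=> oU sf sg; apply: smooth_on_mx => // i j; rewrite -[i](fintype.splitK i).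
case: (fintype.split i) => k /=.
- rewrite (_ : (fun y => _) = fun y => f y k j); first exact: smooth_on_coord.
  by apply/funext => y; rewrite col_mxEu.
- rewrite (_ : (fun y => _) = fun y => g y k j); first exact: smooth_on_coord.
  by apply/funext => y; rewrite col_mxEd.
Qed.

Lemma smooth_on_row_mx (U : set V) (f : V -> 'M[R]_(m, n)) (g : V -> 'M[R]_(m, p)) :
  open U -> smooth_on U f -> smooth_on U g ->
  smooth_on U (fun y => row_mx (f y) (g y)).
Proof.
move=> oU sf sg; rewrite (_ : (fun y => _) = fun y => (col_mx (f y)^T (g y)^T)^T).
  by apply: smooth_on_trmx => //; apply: smooth_on_col_mx => //; exact: smooth_on_trmx.
by apply/funext => y; rewrite tr_col_mx !trmxK.
Qed.

Lemma is_diff_row_mx (f df : V -> 'M[R]_(m, n)) (g dg : V -> 'M[R]_(m, p)) x :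
  is_diff x f df -> is_diff x g dg ->
  is_diff x (fun y => row_mx (f y) (g y)) (fun v => row_mx (df v) (dg v)).
Proof.
move=> hf hg; rewrite (_ : (fun y => _) = fun y => (col_mx (f y)^T (g y)^T)^T).
  apply: (is_diff_ext (is_diff_trmx (is_diff_col_mx (is_diff_trmx hf) (is_diff_trmx hg)))).
  by move=> v; rewrite tr_col_mx !trmxK.
by apply/funext => y; rewrite tr_col_mx !trmxK.
Qed.

End Fun.

Variables (A : set 'cV[R]_n) (B : set 'cV[R]_p).

(** Project a curve of the product, or pair two curves on the intersection of
    their intervals of definition. *)
Lemma tangent_prod z w : tangent (set_prod A B) z w <->
  tangent A (usubmx z) (usubmx w) /\ tangent B (dsubmx z) (dsubmx w).
Proof.
split=> [tw|[[I [g [oI I0 sg gA [g0 gv]]]] [I' [g' [oI' I0' sg' gB [g0' gv']]]]]].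
  have du := @is_diff_usubmx z; have dd := @is_diff_dsubmx z.
  split.
    rewrite -(is_diff_derive w du) -jacE; last exact: is_diff_differentiable du.
    by apply: tangent_map tw; [exact: smooth_on_usubmx (@openT _)|move=> y []].
  rewrite -(is_diff_derive w dd) -jacE; last exact: is_diff_differentiable dd.
  by apply: tangent_map tw; [exact: smooth_on_dsubmx (@openT _)|move=> y []].
have smooth_sub (q : nat) (U U' : set R) (f : R -> 'cV[R]_q) : U' `<=` U ->
    smooth_on U f -> smooth_on U' f.
  move=> UU sf k; elim: k f {sf}(sf k) => [|k IH] f; first by move=> h x /UU /h.
  by move=> [h1 h2]; split=> [x /UU Ux|v]; [exact: h1|exact: IH (h2 v)].
have oII : open (I `&` I') by exact: openI.
have sg1 : smooth_on (I `&` I') g by apply: smooth_sub sg; exact: subIsetl.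
have sg1' : smooth_on (I `&` I') g' by apply: smooth_sub sg'; exact: subIsetr.
exists (I `&` I'), (fun t => col_mx (g t) (g' t)); split=> //.
- exact: smooth_on_col_mx.
- by move=> t [It It']; split; rewrite ?col_mxKu ?col_mxKd; [exact: gA|exact: gB].
- split; first by rewrite g0 g0' vsubmxK.
  have h := is_diff_col_mx (smooth_on_is_diff sg I0) (smooth_on_is_diff sg' I0').
  by rewrite (is_diff_derive _ h) gv gv' vsubmxK.
Qed.

Definition conormal_prod KA KB (cA : KA -> 'cV[R]_n -> 'cV[R]_n)
    (cB : KB -> 'cV[R]_p -> 'cV[R]_p) (k : KA + KB) (z : 'cV[R]_(n + p)) :=
  match k with
  | inl k => col_mx (cA k (usubmx z)) 0
  | inr k => col_mx 0 (cB k (dsubmx z))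
  end.

Lemma conormal_prodP KA KB (cA : KA -> 'cV[R]_n -> 'cV[R]_n)
    (cB : KB -> 'cV[R]_p -> 'cV[R]_p) :
  conormal A cA -> conormal B cB -> conormal (set_prod A B) (conormal_prod cA cB).
Proof.
move=> hA hB z [zA zB]; have [tA HA] := hA _ zA; have [tB HB] := hB _ zB.
split=> [w|].
  rewrite tangent_prod tA tB; split=> [[wA wB]|h].
    by case=> k /=; rewrite -[w]vsubmxK dot_col_mx dot0l ?addr0 ?add0r ?wA ?wB.
  split=> k; first by have := h (inl k);
    rewrite /= -{1}[w]vsubmxK dot_col_mx dot0l addr0.
  by have := h (inr k); rewrite /= -{1}[w]vsubmxK dot_col_mx dot0l add0r.
case=> k.
- have [H sH dH] := HA k; exists (block_mx H 0 0 0).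
    by rewrite tr_block_mx sH !trmx0.
  have h := is_diff_col_mx (is_diff_chain (is_diff_usubmx z) dH) (is_diff_const (0 : 'cV[R]_p) z).
  apply: (is_diff_ext h) => v.
  by rewrite -{2}[v]vsubmxK mul_block_col !mul0mx !addr0.
- have [H sH dH] := HB k; exists (block_mx 0 0 0 H).
    by rewrite tr_block_mx sH !trmx0.
  have h := is_diff_col_mx (is_diff_const (0 : 'cV[R]_n) z) (is_diff_chain (is_diff_dsubmx z) dH).
  apply: (is_diff_ext h) => v.
  by rewrite -{2}[v]vsubmxK mul_block_col !mul0mx !add0r.
Qed.

Variables (JA : 'cV[R]_n -> 'M[R]_n) (JB : 'cV[R]_p -> 'M[R]_p).
Hypotheses (sJA : smooth_on setT JA) (sJB : smooth_on setT JB).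

Definition J_prod (z : 'cV[R]_(n + p)) : 'M[R]_(n + p) :=
  block_mx (JA (usubmx z)) 0 0 (JB (dsubmx z)).

Lemma J_prodE z (w : 'cV[R]_(n + p)) :
  J_prod z *m w = col_mx (JA (usubmx z) *m usubmx w) (JB (dsubmx z) *m dsubmx w).
Proof. by rewrite -{1}[w]vsubmxK mul_block_col !mul0mx addr0 add0r. Qed.

Lemma J_prod_complex :
  (forall x v, A x -> tangent A x v ->
     tangent A x (JA x *m v) /\ JA x *m (JA x *m v) = - v) ->
  (forall x v, B x -> tangent B x v ->
     tangent B x (JB x *m v) /\ JB x *m (JB x *m v) = - v) ->
  forall z w, set_prod A B z -> tangent (set_prod A B) z w ->
    tangent (set_prod A B) z (J_prod z *m w) /\ J_prod z *m (J_prod z *m w) = - w.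
Proof.
move=> hA hB z w [zA zB] /tangent_prod[wA wB].
have [tA eA] := hA _ _ zA wA; have [tB eB] := hB _ _ zB wB.
split; first by apply/tangent_prod; rewrite J_prodE col_mxKu col_mxKd.
by rewrite !J_prodE !col_mxKu !col_mxKd eA eB -opp_col_mx vsubmxK.
Qed.

Lemma smooth_J_prod : smooth_on setT J_prod.
Proof.
have oT := @openT 'cV[R]_(n + p).
apply: smooth_on_col_mx => //; apply: smooth_on_row_mx => //;
  try exact: smooth_on_const.
- exact: (smooth_on_comp oT (@openT _) (smooth_on_usubmx oT)).
- exact: (smooth_on_comp oT (@openT _) (smooth_on_dsubmx oT)).
Qed.

(** Each block of [J_prod] depends on its own variable only. *)
Lemma nij_form_prod z u v :
  nij_form J_prod z u v =
  col_mx (nij_form JA (usubmx z) (usubmx u) (usubmx v))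
         (nij_form JB (dsubmx z) (dsubmx u) (dsubmx v)).
Proof.
have DJ a (b : 'cV[R]_(n + p)) a1 a2 : usubmx a = a1 -> dsubmx a = a2 ->
    'D_a J_prod z *m b =
    col_mx ('D_a1 JA (usubmx z) *m usubmx b) ('D_a2 JB (dsubmx z) *m dsubmx b).
  move=> <- <-.
  have hA := is_diff_chain (is_diff_usubmx z) (smooth_on_is_diff sJA (Logic.I : setT (usubmx z))).
  have hB := is_diff_chain (is_diff_dsubmx z) (smooth_on_is_diff sJB (Logic.I : setT (dsubmx z))).
  have h := is_diff_col_mx (is_diff_row_mx hA (is_diff_const (0 : 'M[R]_(n, p)) z))
    (is_diff_row_mx (is_diff_const (0 : 'M[R]_(p, n)) z) hB).
  rewrite (is_diff_derive a h) -{1}[b]vsubmxK -/(block_mx _ _ _ _) mul_block_col.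
  by rewrite !mul0mx addr0 add0r.
have comb (a b c d : 'cV[R]_n) (a' b' c' d' : 'cV[R]_p) :
    col_mx a a' - col_mx b b' - J_prod z *m (col_mx c c' - col_mx d d') =
    col_mx (a - b - JA (usubmx z) *m (c - d)) (a' - b' - JB (dsubmx z) *m (c' - d')).
  rewrite !opp_col_mx !add_col_mx J_prodE col_mxKu col_mxKd.
  by rewrite opp_col_mx add_col_mx.
have Ju (w : 'cV[R]_(n + p)) :
    usubmx (J_prod z *m w) = JA (usubmx z) *m usubmx w by rewrite J_prodE col_mxKu.
have Jd (w : 'cV[R]_(n + p)) :
    dsubmx (J_prod z *m w) = JB (dsubmx z) *m dsubmx w by rewrite J_prodE col_mxKd.
apply: etrans (comb _ _ _ _ _ _ _ _).
apply: (congr2 (fun a b => a - b)).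
  by apply: (congr2 (fun a b => a - b)); [exact: DJ (Ju u) (Jd u)|exact: DJ (Ju v) (Jd v)].
apply: (congr1 (mulmx (J_prod z))).
by apply: (congr2 (fun a b => a - b)); exact: DJ.
Qed.

End Product.

(** * Quadrics of Clifford systems and their tangent spaces *)

Definition clifford_system (R : realType) (n q : nat) (P : 'I_q -> 'M[R]_n) : Prop :=
  (forall i, (P i)^T = P i) /\
  (forall i j, P i *m P j + P j *m P i = ((i == j)%:R *+ 2)%:M).

Definition clifford_quadric (R : realType) (n q : nat) (P : 'I_q -> 'M[R]_n) :
    set 'cV[R]_n :=
  [set x | dot x x = 1 /\ forall i, dot (P i *m x) x = 0].

(** Half the gradients of the equations: [None] stands for the sphere and [Some i]
    for the quadratic form of [P i]. *)
Definition clifford_conormal (R : realType) (n q : nat) (P : 'I_q -> 'M[R]_n)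
    (k : option 'I_q) (x : 'cV[R]_n) : 'cV[R]_n :=
  if k is Some i then P i *m x else x.

Section CliffordFamily.
Variables (R : realType) (n q : nat) (P : 'I_q -> 'M[R]_n).
Hypothesis hP : clifford_system P.
Implicit Types (a b : 'I_q -> R) (x y z v : 'cV[R]_n).

Let symP i : (P i)^T = P i. Proof. by case: hP. Qed.

Definition clifford_comb a : 'M[R]_n := \sum_i a i *: P i.

Lemma tr_comb a : (clifford_comb a)^T = clifford_comb a.
Proof.
rewrite /clifford_comb [LHS](big_morph _ (@linearD _ _ _ _ (@trmx R n n)) (@trmx0 R n n)).
by apply: eq_bigr => i _; rewrite linearZ /= symP.
Qed.

Lemma comb_anti a j : P j *m clifford_comb a + clifford_comb a *m P j = (a j *+ 2)%:M.
Proof.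
rewrite /clifford_comb mulmx_sumr mulmx_suml -big_split (bigD1 j) //= big1 => [|i ij].
  rewrite -scalemxAr -scalemxAl -scalerDr (hP.2 j j) eqxx addr0.
  by rewrite scale_scalar_mx -mulr_natr mulrA mulr1 mulr_natr.
rewrite -scalemxAr -scalemxAl -scalerDr (hP.2 j i) eq_sym (negPf ij).
by rewrite mul0rn scale_scalar_mx mulr0 raddf0.
Qed.

Lemma comb_mul a b :
  clifford_comb a *m clifford_comb b + clifford_comb b *m clifford_comb a =
  ((\sum_i a i * b i) *+ 2)%:M.
Proof.
rewrite {1}/clifford_comb {2}/clifford_comb mulmx_suml mulmx_sumr -big_split /=.
rewrite -sumrMnl raddf_sum; apply: eq_bigr => i _.
rewrite -scalemxAr -scalemxAl -scalerDr comb_anti scale_scalar_mx.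
by rewrite mulrnAr.
Qed.

Lemma comb_sq a : clifford_comb a *m clifford_comb a = (\sum_i a i ^+ 2)%:M.
Proof.
have n2 : 2 != 0 :> R by rewrite pnatr_eq0.
apply: (scalerI n2); rewrite !scaler_nat mulr2n comb_mul.
rewrite -scaler_nat scale_scalar_mx mulr_natl.
by congr ((_ *+ 2)%:M); apply: eq_bigr => i _; rewrite expr2.
Qed.

Lemma comb_dot a x : dot (clifford_comb a *m x) x = \sum_i a i * dot (P i *m x) x.
Proof.
rewrite /clifford_comb mulmx_suml dot_suml; apply: eq_bigr => i _.
by rewrite -scalemxAl dotZl.
Qed.

(** Symmetrize: the product of the two matrices has scalar symmetric part. *)
Lemma comb_dotP a x j : dot (P j *m x) (clifford_comb a *m x) = a j * dot x x.
Proof.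
have e : dot x ((P j *m clifford_comb a + clifford_comb a *m P j) *m x) =
    dot (P j *m x) (clifford_comb a *m x) *+ 2.
  rewrite mulmxDl dotDr -!mulmxA mulr2n; congr (_ + _).
    by rewrite dot_mulmx symP.
  by rewrite dotC dot_mulmx tr_comb.
move: e; rewrite comb_anti mul_scalar_mx dotZr mulrnAl => /eqP.
by rewrite eqrMn2r //= => /eqP.
Qed.

Lemma comb_dotcl a x :
  dot (clifford_comb a *m x) (clifford_comb a *m x) = (\sum_i a i ^+ 2) * dot x x.
Proof. by rewrite dot_mulmx tr_comb mulmxA comb_sq mul_scalar_mx dotZr. Qed.

Lemma dotP x i j : dot (P i *m x) (P j *m x) = (i == j)%:R * dot x x.
Proof.
have -> : P j = clifford_comb (fun k => (k == j)%:R).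
  rewrite /clifford_comb (bigD1 j) //= eqxx scale1r big1 ?addr0 // => k /negPf ->.
  by rewrite scale0r.
by rewrite comb_dotP.
Qed.

Section Combination.
Variables (s : R) (a : 'I_q -> R) (y : 'cV[R]_n).
Let z := s *: y + clifford_comb a *m y.
Let pa := \sum_i a i * dot (P i *m y) y.
Let a2 := \sum_i a i ^+ 2.

Lemma dot_comb : dot z z = s ^+ 2 * dot y y + 2 * s * pa + a2 * dot y y.
Proof.
rewrite /z !(dotDl, dotDr, dotZl, dotZr) comb_dotcl (dotC y) comb_dot -/pa -/a2.
ring.
Qed.

(** By the Clifford relations, [Q P_j Q = 2 a_j Q - |a|^2 P_j] for
    [Q = clifford_comb a]; hence the values of the quadratic forms at
    [s y + Q y] only depend on those at [y]. *)
Lemma dotP_comb j : dot (P j *m z) z =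
  (s ^+ 2 - a2) * dot (P j *m y) y + 2 * a j * (s * dot y y + pa).
Proof.
rewrite /z mulmxDr -scalemxAr !(dotDl, dotDr, dotZl, dotZr) comb_dotP.
have e1 : dot (P j *m (clifford_comb a *m y)) y = a j * dot y y.
  by rewrite sym_dot // comb_dotP.
have e2 : dot (P j *m (clifford_comb a *m y)) (clifford_comb a *m y) =
    2 * a j * pa - a2 * dot (P j *m y) y.
  have e : clifford_comb a *m P j *m clifford_comb a = (2 * a j) *: clifford_comb a - a2 *: P j.
    have -> : clifford_comb a *m P j = (a j *+ 2)%:M - P j *m clifford_comb a.
      by rewrite -(comb_anti a j) [P j *m _ + _]addrC addrK.
    rewrite mulmxBl -mulmxA comb_sq mul_scalar_mx mul_mx_scalar.
    by rewrite mulr_natl.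
  rewrite dotC dot_mulmx tr_comb dotC !mulmxA e.
  by rewrite mulmxBl -!scalemxAl dotBl !dotZl comb_dot.
rewrite e1 e2; ring.
Qed.

End Combination.

Lemma quadric_tangent_eqs x v : tangent (clifford_quadric P) x v ->
  forall k, dot (clifford_conormal P k x) v = 0.
Proof.
move=> tv; case=> [i|] /=.
- have h := is_diff_dot (is_diff_lin (P i) (is_diff_id x)) (is_diff_id x).
  have := tangent_image tv (@openT _) Logic.I h => /= e.
  have {e} : dot (P i *m v) x + dot (P i *m x) v = 0 by apply: e => y [_ ->].
  rewrite sym_dot // -mulr2n => /eqP; rewrite mulrn_eq0 => /eqP //.
- have h := is_diff_add (is_diff_dot (is_diff_id x) (is_diff_id x)) (is_diff_const (-1 : R) x).
  have := tangent_image tv (@openT _) Logic.I h => /= e.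
  have {e} : dot v x + dot x v + 0 = 0 by apply: e => y [-> _]; rewrite subrr.
  rewrite addr0 dotC -mulr2n => /eqP; rewrite mulrn_eq0 => /eqP //.
Qed.

(** An even function equals its composite with [t |-> - t], whose derivative at 0
    is the opposite one. *)
Lemma derive_even (h : R -> R) (t0 : R) : differentiable h 0 ->
  (forall t, h (- t) = h t) -> 'D_t0 h 0 = 0.
Proof.
move=> dh ev; have hh := differentiableP dh.
have hN := is_diff_opp (is_diff_id (0 : R)).
have h2 : is_diff (- (0 : R)) h ('d h (0 : R)).
  by rewrite oppr0; exact: hh.
have h3 := is_diff_chain hN h2.
have e : 'd h (0 : R) t0 = 'd h (0 : R) (- t0).
  rewrite -(is_diff_derive t0 h3) -(is_diff_derive t0 hh).
  by rewrite (_ : (fun t => h (- t)) = h) //; apply/funext => t; exact: ev.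
rewrite (is_diff_derive t0 hh); move: e; rewrite linearN => /eqP.
by rewrite -addr_eq0 -mulr2n mulrn_eq0 => /eqP.
Qed.

Section Curve.
Variables (x v : 'cV[R]_n).
Hypotheses (qx : clifford_quadric P x).
Hypothesis hv : forall k, dot (clifford_conormal P k x) v = 0.

Let y (t : R) := x + t *: v.
Let r (t : R) : R := 1 + t * t * dot v v.
Let p (i : 'I_q) (t : R) : R := t * t * dot (P i *m v) v.
Let d (t : R) : R := r t * r t + (-1) * \sum_i p i t * p i t.
Let s (t : R) : R := Num.sqrt (d t).
Let N (t : R) : R := s t * Num.sqrt (2 * (r t + s t)).
Let phi (t : R) : R := (r t + s t) * (N t)^-1.
Let psi (i : 'I_q) (t : R) : R := (-1) * (p i t * (N t)^-1).

(** The line [y t = x + t v] followed by the polar retraction onto the quadric.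
    With [r = |y|^2] and [p_i = <P_i y, y>], the vector
    [(r + s) y - sum_i p_i P_i y] solves all the equations [<P_i z, z> = 0]
    when [s^2 = r^2 - sum_i p_i^2], by [dotP_comb]; it has norm
    [N = s sqrt (2 (r + s))]. *)
Definition quadric_curve (t : R) : 'cV[R]_n :=
  phi t *: y t + clifford_comb (psi ^~ t) *m y t.

Let Iv : set R := [set t | 0 < d t].

Let dot_y t : dot (y t) (y t) = r t.
Proof.
have xv : dot x v = 0 by exact: (hv None).
rewrite /y !(dotDl, dotDr, dotZl, dotZr) (dotC v x) xv qx.1 /r; ring.
Qed.

Let dotP_y i t : dot (P i *m y t) (y t) = p i t.
Proof.
have xv : dot (P i *m x) v = 0 by exact: (hv (Some i)).
rewrite /y mulmxDr -scalemxAr !(dotDl, dotDr, dotZl, dotZr).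
by rewrite (sym_dot v x (symP i)) xv qx.2 /p; ring.
Qed.

Let r_ge1 t : 1 <= r t.
Proof. by rewrite lerDl mulr_ge0 ?dot_ge0 // -expr2 sqr_ge0. Qed.

Let s_gt0 t : Iv t -> 0 < s t. Proof. by move=> h; rewrite sqrtr_gt0. Qed.

Let rs_gt0 t : 0 < r t + s t.
Proof. by rewrite ltr_pwDl ?sqrtr_ge0 // (lt_le_trans ltr01) ?r_ge1. Qed.

Let N_neq0 t : Iv t -> N t != 0.
Proof.
move=> It; rewrite mulf_neq0 // gt_eqF ?s_gt0 // sqrtr_gt0.
by rewrite mulr_gt0 ?rs_gt0.
Qed.

Let s2 t : Iv t -> s t * s t = d t.
Proof. by move=> It; rewrite -expr2 sqr_sqrtr // ltW. Qed.

Let N2 t : Iv t -> N t * N t = 2 * (s t * s t) * (r t + s t).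
Proof.
move=> It; rewrite /N mulrACA -[X in _ * X]expr2 sqr_sqrtr; first by ring.
by rewrite mulr_ge0 // ltW ?rs_gt0.
Qed.

Let sum_p2 t : Iv t -> \sum_i p i t * p i t = r t * r t - s t * s t.
Proof. by move=> It; rewrite s2 // /d; ring. Qed.

Let psi_p t : Iv t ->
  \sum_i psi i t * p i t = - (N t)^-1 * (r t * r t - s t * s t).
Proof.
move=> It; rewrite -sum_p2 // mulr_sumr; apply: eq_bigr => i _; rewrite /psi.
by move: (N t)^-1 => n0; ring.
Qed.

Let psi2 t : Iv t ->
  \sum_i psi i t ^+ 2 = (N t)^-1 ^+ 2 * (r t * r t - s t * s t).
Proof.
move=> It; rewrite -sum_p2 // mulr_sumr; apply: eq_bigr => i _; rewrite /psi.
by move: (N t)^-1 => n0; ring.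
Qed.

Lemma quadric_curve_in t : Iv t -> clifford_quadric P (quadric_curve t).
Proof.
move=> It; have nn : (N t)^-1 * (N t)^-1 * (2 * (s t * s t) * (r t + s t)) = 1.
  by rewrite -N2 // mulrACA mulVf ?mul1r // N_neq0.
have pE : \sum_i psi i t * dot (P i *m y t) (y t) = - (N t)^-1 * (r t * r t - s t * s t).
  by rewrite -psi_p //; apply: eq_bigr => i _; rewrite dotP_y.
split=> [|j].
- rewrite dot_comb pE psi2 // dot_y /phi -[RHS]nn.
  by move: (N t)^-1 => n0; ring.
- rewrite dotP_comb pE psi2 // dotP_y dot_y /phi /psi.
  by move: (N t)^-1 => n0; ring.
Qed.

Let oT := @openT R.

Let smooth_t (U : set R) : open U -> smooth_on U (fun t : R => t).
Proof. move=> oU; exact: (smooth_on_id oU). Qed.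

Let smooth_t2 (U : set R) (c : R) : open U -> smooth_on U (fun t : R => t * t * c).
Proof.
move=> oU; apply: smooth_on_mul => //; last exact: smooth_on_const.
by apply: smooth_on_mul => //; exact: smooth_t.
Qed.

Let smooth_p (U : set R) i : open U -> smooth_on U (p i).
Proof. exact: smooth_t2. Qed.

Let smooth_r (U : set R) : open U -> smooth_on U r.
Proof.
move=> oU; apply: smooth_on_add => //; [exact: smooth_on_const|exact: smooth_t2].
Qed.

Let smooth_d (U : set R) : open U -> smooth_on U d.
Proof.
move=> oU; apply: smooth_on_add => //.
  by apply: smooth_on_mul => //; exact: smooth_r.
apply: smooth_on_mul => //; first exact: smooth_on_const.
by apply: smooth_on_sum => // i; apply: smooth_on_mul => //; exact: smooth_p.
Qed.

Let open_Iv : open Iv.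
Proof.
have -> : Iv = d @^-1` [set z | 0 < z] by [].
apply: open_comp; last exact: open_gt.
by move=> t _; apply/differentiable_continuous/(smooth_on_diff (smooth_d oT)).
Qed.

Let smooth_s : smooth_on Iv s.
Proof. by apply: smooth_on_sqrt => //; exact: smooth_d. Qed.

Let smooth_rs : smooth_on Iv (fun t => r t + s t).
Proof. by apply: smooth_on_add => //; exact: smooth_r. Qed.

Let smooth_N : smooth_on Iv (fun t => (N t)^-1).
Proof.
apply: smooth_on_inv => //; apply: smooth_on_mul => //.
apply: smooth_on_sqrt => // [t _|]; first by rewrite mulr_gt0 ?rs_gt0.
by apply: smooth_on_mul => //; exact: smooth_on_const.
Qed.

Let smooth_phi : smooth_on Iv phi.
Proof. exact: smooth_on_mul. Qed.

Let smooth_psi i : smooth_on Iv (psi i).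
Proof.
apply: smooth_on_mul => //; first exact: smooth_on_const.
by apply: smooth_on_mul => //; exact: smooth_p.
Qed.

Let smooth_y : smooth_on Iv y.
Proof.
apply: smooth_on_addmx => //; first exact: smooth_on_const.
by apply: smooth_on_scalemx => //; [exact: smooth_t|exact: smooth_on_const].
Qed.

Let smooth_cl : smooth_on Iv (fun t => clifford_comb (psi ^~ t)).
Proof.
apply: smooth_on_summx => // i; apply: smooth_on_scalemx => //.
exact: smooth_on_const.
Qed.

Lemma smooth_quadric_curve : smooth_on Iv quadric_curve.
Proof.
apply: smooth_on_addmx => //; first exact: smooth_on_scalemx.
exact: smooth_on_mulmx.
Qed.

Let d0 : d 0 = 1.
Proof.
rewrite /d /r !mul0r addr0 mulr1 big1 ?mulr0 ?addr0 // => i _.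
by rewrite /p !mul0r.
Qed.

Let Iv0 : Iv 0. Proof. by rewrite /Iv /= d0. Qed.

Let phi0 : phi 0 = 1.
Proof.
rewrite /phi /N /s d0 sqrtr1 /r !mul0r addr0 mul1r.
have -> : 2 * (1 + 1) = 2 ^+ 2 :> R by ring.
by rewrite sqrtr_sqr ger0_norm // mulfV.
Qed.

Let psi0 i : psi i 0 = 0. Proof. by rewrite /psi /p !mul0r mulr0. Qed.

Let r_even t : r (- t) = r t. Proof. by rewrite /r mulrNN. Qed.
Let p_even i t : p i (- t) = p i t. Proof. by rewrite /p mulrNN. Qed.
Let d_even t : d (- t) = d t.
Proof.
by rewrite /d r_even; congr (_ + _ * _); apply: eq_bigr => i _; rewrite p_even.
Qed.
Let N_even t : N (- t) = N t. Proof. by rewrite /N /s r_even d_even. Qed.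

(** The scalar coefficients only depend on [t ^ 2], so their derivatives vanish
    at 0 and the velocity is that of the line. *)
Lemma quadric_curve_velocity : quadric_curve 0 = x /\ 'D_1 quadric_curve 0 = v.
Proof.
have y0 : y 0 = x by rewrite /y scale0r addr0.
have cl0 : clifford_comb (fun i => 0) = 0 by apply: big1 => i _; rewrite scale0r.
have clpsi0 : clifford_comb (psi ^~ 0) = 0.
  by rewrite -cl0; congr clifford_comb; apply/funext => i; rewrite psi0.
split; first by rewrite /quadric_curve phi0 y0 clpsi0 mul0mx addr0 scale1r.
have hy : is_diff (0 : R) y (fun t => t *: v).
  apply: (is_diff_ext (is_diff_add (is_diff_const x (0 : R)) (is_diff_scalel (0 : R) v))).
  by move=> t; rewrite add0r.
have hphi : is_diff (0 : R) phi (fun t => 0).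
  apply: (is_diff_ext (smooth_on_is_diff smooth_phi Iv0)) => t.
  apply: derive_even; first exact: (smooth_on_diff smooth_phi).
  by move=> u; rewrite /phi N_even r_even /s d_even.
have hpsi i : is_diff (0 : R) (psi i) (fun t => 0).
  apply: (is_diff_ext (smooth_on_is_diff (smooth_psi i) Iv0)) => t.
  apply: derive_even; first exact: (smooth_on_diff (smooth_psi i)).
  by move=> u; rewrite /psi N_even p_even.
have hcl : is_diff (0 : R) (fun t => clifford_comb (psi ^~ t)) (fun t => 0).
  have h := is_diff_sum (fun i => is_diff_scalemx (hpsi i) (is_diff_const (P i) (0 : R))).
  apply: (is_diff_ext h) => t; rewrite big1 // => i _.
  by rewrite scale0r scaler0 addr0.
have h := is_diff_add (is_diff_scalemx hphi hy) (is_diff_mulmx hcl hy).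
have /= := is_diff_derive (1 : R) h.
by rewrite scale0r add0r mul0mx add0r clpsi0 mul0mx addr0 phi0 !scale1r.
Qed.

Lemma tangent_quadric_curve : tangent (clifford_quadric P) x v.
Proof.
exists Iv, quadric_curve; split=> //.
- exact: smooth_quadric_curve.
- exact: quadric_curve_in.
- exact: quadric_curve_velocity.
Qed.

End Curve.

Lemma quadric_conormal : conormal (clifford_quadric P) (clifford_conormal P).
Proof.
move=> x qx; split=> [v|k].
  by split=> [|h]; [exact: quadric_tangent_eqs|exact: tangent_quadric_curve].
case: k => [i|] /=.
  exists (P i) => //.
  by apply: (is_diff_ext (is_diff_lin (P i) (is_diff_id x))).
exists 1%:M; first by rewrite trmx1.
by apply: (is_diff_ext (is_diff_id x)) => v; rewrite mul1mx.
Qed.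

End CliffordFamily.

(** * Complex structures transverse to a holomorphic foliation *)

Section Frame.
Variables (R : realType) (n r : nat) (A : set 'cV[R]_n).
Variables (J0 : 'M[R]_n) (E nu : 'I_r -> 'M[R]_n).

(** When [nu] and [E] are dual to each other at [x], this is the projection onto the
    vectors orthogonal to the [nu a x] along the span of the [E a x]. *)
Definition frame_proj (x : 'cV[R]_n) : 'M[R]_n :=
  1%:M - \sum_a (E a *m x) *m (nu a *m x)^T.

Definition frame_J x : 'M[R]_n := frame_proj x *m J0.

Let pi := frame_proj.

Lemma frame_projE x (w : 'cV[R]_n) :
  pi x *m w = w - \sum_a dot (nu a *m x) w *: (E a *m x).
Proof.
rewrite /pi /frame_proj mulmxBl mul1mx mulmx_suml; congr (_ - _).
by apply: eq_bigr => a _; rewrite mul_outer.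
Qed.

Hypothesis J0J0 : J0 *m J0 = - 1%:M.
Hypothesis EJ0 : forall a, E a *m J0 = J0 *m E a.
Hypothesis piE : forall x a, A x -> pi x *m (E a *m x) = 0.
Hypothesis piJE : forall x a, A x -> pi x *m (J0 *m (E a *m x)) = 0.
Hypothesis piC : forall x a b, A x ->
  pi x *m (E a *m (E b *m x)) = pi x *m (E b *m (E a *m x)).
Hypothesis piT : forall x v, A x -> tangent A x v -> pi x *m v = v.
Hypothesis JT : forall x v, A x -> tangent A x v -> tangent A x (pi x *m (J0 *m v)).

Let pipi x (w : 'cV[R]_n) : A x -> pi x *m (pi x *m w) = pi x *m w.
Proof.
move=> Ax; rewrite [pi x *m w in LHS]frame_projE mulmxBr mulmx_sumr big1 ?subr0 // => a _.
by rewrite -scalemxAr piE // scaler0.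
Qed.

Let piJpi x (w : 'cV[R]_n) : A x -> pi x *m (J0 *m (pi x *m w)) = pi x *m (J0 *m w).
Proof.
move=> Ax; rewrite [pi x *m w in LHS]frame_projE !mulmxBr.
rewrite [J0 *m \sum_a _]mulmx_sumr mulmx_sumr big1 ?subr0 // => a _.
by rewrite -!scalemxAr piJE // scaler0.
Qed.

Lemma frame_J_complex x v : A x -> tangent A x v ->
  tangent A x (frame_J x *m v) /\ frame_J x *m (frame_J x *m v) = - v.
Proof.
move=> Ax tv; rewrite /frame_J -!mulmxA; split; first exact: JT.
by rewrite piJpi // (mulmxA J0) J0J0 mulNmx mul1mx mulmxN piT.
Qed.

Lemma smooth_frame_J : smooth_on setT frame_J.
Proof.
have oT := @openT 'cV[R]_n; have sid := smooth_on_id oT.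
have sL (M : 'M[R]_n) : smooth_on setT (fun x : 'cV[R]_n => M *m x).
  by apply: smooth_on_mulmx => //; exact: smooth_on_const.
apply: smooth_on_mulmx => //; last exact: smooth_on_const.
apply: smooth_on_addmx => //; first exact: smooth_on_const.
apply: smooth_on_oppmx => //; apply: smooth_on_summx => // a.
by apply: smooth_on_mulmx => //; apply: smooth_on_trmx.
Qed.

Let alpha x a (v : 'cV[R]_n) := dot (nu a *m x) (J0 *m v).

Let frame_Jv x (v : 'cV[R]_n) : frame_J x *m v = J0 *m v - \sum_a alpha x a v *: (E a *m x).
Proof. by rewrite /frame_J -mulmxA frame_projE. Qed.

(** Differentiating the coefficient of [E a x] gives a multiple of [E a x], which
    the projection kills; differentiating [E a x] itself gives [E a w]. *)
Lemma frame_DJ x w (v : 'cV[R]_n) : A x ->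
  pi x *m ('D_w frame_J x *m v) = - \sum_a alpha x a v *: (pi x *m (E a *m w)).
Proof.
move=> Ax.
have hL (M : 'M[R]_n) := is_diff_lin M (is_diff_id x).
have hs := is_diff_sum (fun a => is_diff_mulmx (hL (E a)) (is_diff_trmx (hL (nu a)))).
have h := is_diff_mulmx (is_diff_add (is_diff_const 1%:M x) (is_diff_opp hs))
                        (is_diff_const J0 x).
rewrite (is_diff_derive w h) /= mulmx0 addr0 add0r -(mulmxA _ J0) mulNmx mulmxN.
rewrite mulmx_suml mulmx_sumr; congr (- _); apply: eq_bigr => a _.
rewrite [X in pi x *m X = _]mulmxDl !mul_outer mulmxDr -!scalemxAr piE //.
by rewrite scaler0 addr0.
Qed.

(** All terms of [nij_form] become combinations of the [pi (E a (J0 u))] and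
    [pi (E a (J0 v))], which cancel because [E a] commutes with [J0], and of a
    double sum over [E a E b x], which is symmetric modulo the foliation. *)
Lemma frame_nij x u v : A x -> pi x *m nij_form frame_J x u v = 0.
Proof.
move=> Ax.
pose S (w z : 'cV[R]_n) : 'cV[R]_n := \sum_a alpha x a z *: (pi x *m (E a *m w)).
have DJ w (z : 'cV[R]_n) : pi x *m ('D_w frame_J x *m z) = - S w z by exact: frame_DJ.
have ES (w z : 'cV[R]_n) : S (frame_J x *m w) z = S (J0 *m w) z -
    \sum_a \sum_b (alpha x a z * alpha x b w) *: (pi x *m (E a *m (E b *m x))).
  rewrite -sumrB; apply: eq_bigr => a _.
  rewrite frame_Jv mulmxBr mulmxBr scalerBr; congr (_ - _).
  rewrite [E a *m \sum_b _]mulmx_sumr mulmx_sumr scaler_sumr; apply: eq_bigr => b _.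
  by rewrite -!scalemxAr scalerA.
have JS (w z : 'cV[R]_n) : pi x *m (J0 *m S w z) = S (J0 *m w) z.
  rewrite [J0 *m S w z]mulmx_sumr mulmx_sumr; apply: eq_bigr => a _.
  by rewrite -!scalemxAr piJpi // (mulmxA (E a)) EJ0 -mulmxA.
have comb (a b c d : 'cV[R]_n) : pi x *m a = - S (frame_J x *m u) v ->
    pi x *m b = - S (frame_J x *m v) u -> pi x *m c = - S u v ->
    pi x *m d = - S v u -> pi x *m (a - b - frame_J x *m (c - d)) = 0.
  move=> ea eb ec ed.
  rewrite mulmxBr [pi x *m (a - b)]mulmxBr ea eb.
  rewrite (_ : frame_J x *m (c - d) = pi x *m (J0 *m (c - d))); last by rewrite mulmxA.
  rewrite pipi //.
  rewrite -piJpi // [pi x *m (c - d)]mulmxBr ec ed !(mulmxBr, mulmxN) !JS !ES.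
  have -> : \sum_a0 \sum_b0 (alpha x a0 u * alpha x b0 v) *: (pi x *m (E a0 *m (E b0 *m x)))
      = \sum_a0 \sum_b0 (alpha x a0 v * alpha x b0 u) *: (pi x *m (E a0 *m (E b0 *m x))).
    rewrite exchange_big; apply: eq_bigr => a0 _; apply: eq_bigr => b0 _.
    by rewrite mulrC piC.
  move: (S _ _) (S _ _) (\sum_a0 _) => s1 s2 s3.
  by apply/matrixP => i j; rewrite !mxE; ring.
by apply: comb; exact: DJ.
Qed.

Lemma frame_nij_form : forall x u v, A x -> tangent A x u -> tangent A x v ->
  tangent A x (nij_form frame_J x u v) -> nij_form frame_J x u v = 0.
Proof. by move=> x u v Ax _ _ tN; rewrite -(piT Ax tN); exact: frame_nij. Qed.

End Frame.

(** * The frame of a triple of Clifford matrices *)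

Lemma cV_eq (R : realType) m n (A B : 'M[R]_(m, n)) :
  (forall x : 'cV[R]_n, A *m x = B *m x) -> A = B.
Proof.
move=> e; apply/matrixP => i j.
have := congr1 (fun M : 'cV[R]_m => M i 0) (e (delta_mx j 0)).
by rewrite -!colE !mxE.
Qed.

(** Linear identities between vectors in which the products of a matrix with a
    vector are atoms. *)
Ltac vec_ring :=
  apply/matrixP => ? ?;
  repeat match goal with |- context [mulmx ?M ?x] => move: (mulmx M x) => ? end;
  rewrite !mxE; ring.

Section CliffordFrame.
Variables (R : realType) (n : nat) (p q r : 'M[R]_n).
Hypotheses (tp : p^T = p) (tq : q^T = q) (tr : r^T = r).
Hypotheses (pp : forall x : 'cV[R]_n, p *m (p *m x) = x)
           (qq : forall x : 'cV[R]_n, q *m (q *m x) = x)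
           (rr : forall x : 'cV[R]_n, r *m (r *m x) = x)
           (qp : forall x : 'cV[R]_n, q *m (p *m x) = - (p *m (q *m x)))
           (rp : forall x : 'cV[R]_n, r *m (p *m x) = - (p *m (r *m x)))
           (rq : forall x : 'cV[R]_n, r *m (q *m x) = - (q *m (r *m x))).

Definition clifford_J0 : 'M[R]_n := p *m q *m r.

(** With [J0 = p q r] playing the role of i, these are a generator of the
    strictly triangular matrices, [i] times it, the diagonal element
    [1 + q r = 1 + i p], and [i] times it. *)
Definition clifford_frame (k : 'I_4) : 'M[R]_n :=
  nth 0 [:: q + p *m q; r *m p - r; 1%:M + q *m r; p *m q *m r - p] k.

(** The normal covectors dual to [clifford_frame] on the quadric. *)
Definition clifford_conormals (k : 'I_4) : 'M[R]_n :=
  nth 0 [:: q; - r; 1%:M; - p] k.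

Let J0 := clifford_J0.
Let E := clifford_frame.
Let nu := clifford_conormals.
Let words := (pp, qq, rr, qp, rp, rq).

Lemma clifford_JE (x : 'cV[R]_n) : J0 *m x = p *m (q *m (r *m x)).
Proof. by rewrite /J0 /clifford_J0 -!mulmxA. Qed.

(** Products of the three matrices are applied to vectors and sorted with [p]
    before [q] before [r]; all later identities are checked on these normal forms. *)
Lemma clifford_frameE (k : 'I_4) (x : 'cV[R]_n) : E k *m x =
  nth 0 [:: q *m x + p *m (q *m x); - (p *m (r *m x)) - r *m x;
            x + q *m (r *m x); p *m (q *m (r *m x)) - p *m x] k.
Proof.
rewrite /E /clifford_frame; case: k => [[|[|[|[|//]]]] hk] /=.
- by rewrite mulmxDl -mulmxA.
- by rewrite mulmxBl -mulmxA rp.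
- by rewrite mulmxDl -mulmxA mul1mx.
- by rewrite mulmxBl -!mulmxA.
Qed.

Lemma clifford_conormalsE (k : 'I_4) (x : 'cV[R]_n) : nu k *m x =
  nth 0 [:: q *m x; - (r *m x); x; - (p *m x)] k.
Proof.
rewrite /nu /clifford_conormals; case: k => [[|[|[|[|//]]]] hk] /=;
  by rewrite ?mulNmx ?mul1mx.
Qed.

Lemma clifford_J0J0 : J0 *m J0 = - 1%:M.
Proof.
apply: cV_eq => x; rewrite -mulmxA mulNmx mul1mx !clifford_JE.
by rewrite !(words, mulmxN, mulmxDr, opprK).
Qed.

Lemma clifford_frame_J0 (k : 'I_4) : E k *m J0 = J0 *m E k.
Proof.
apply: cV_eq => x; rewrite -(mulmxA (E k)) -(mulmxA J0) !clifford_JE !clifford_frameE.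
case: k => [[|[|[|[|//]]]] hk] /=;
rewrite ?(words, mulmxN, mulmxDr, opprK, opprD); vec_ring.
Qed.

Lemma clifford_J0_frame (k : 'I_4) : exists (l : 'I_4) (s : R),
  forall x : 'cV[R]_n, J0 *m (E k *m x) = s *: (E l *m x).
Proof.
pose o (i : nat) : 'I_4 := inord i.
exists (nth 0 [:: o 1; o 0; o 3; o 2] k), (nth 0 [:: 1; -1; 1; -1] k) => x.
rewrite clifford_JE !clifford_frameE.
case: k => [[|[|[|[|//]]]] hk] /=; rewrite inordK //=;
rewrite ?(words, mulmxN, mulmxDr, opprK, opprD); vec_ring.
Qed.

(** The only bracket to know is that of the nilpotent generator with the diagonal
    one, a multiple of [i] times the former; the others follow from complex
    linearity. *)
Lemma clifford_frame_comm (k l : 'I_4) : exists (h : 'I_4) (s : R),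
  forall x : 'cV[R]_n, E k *m (E l *m x) = E l *m (E k *m x) + s *: (E h *m x).
Proof.
pose o (i : nat) : 'I_4 := inord i.
(* The bracket is a multiple of the nilpotent generator when exactly one of the
   two fields carries a factor i, and of i times that generator otherwise. *)
exists (if (k + l == 3)%N then o 0 else o 1).
exists (nth 0 (nth [::] [:: [:: 0; 0; -2; 2]; [:: 0; 0; 2; 2];
                            [:: 2; -2; 0; 0]; [:: -2; -2; 0; 0]] k) l) => x.
rewrite !clifford_frameE.
case: k => [[|[|[|[|//]]]] hk]; case: l => [[|[|[|[|//]]]] hl]; rewrite /= inordK //=;
rewrite ?(words, mulmxN, mulmxDr, opprK, opprD); vec_ring.
Qed.

Variable A : set 'cV[R]_n.
Hypothesis hA : forall x, A x ->
  [/\ dot x x = 1, dot x (p *m x) = 0, dot x (q *m x) = 0 & dot x (r *m x) = 0].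

Let dp (u v : 'cV[R]_n) : dot (p *m u) v = dot u (p *m v).
Proof. by rewrite dot_mulmx tp. Qed.
Let dq (u v : 'cV[R]_n) : dot (q *m u) v = dot u (q *m v).
Proof. by rewrite dot_mulmx tq. Qed.
Let dr (u v : 'cV[R]_n) : dot (r *m u) v = dot u (r *m v).
Proof. by rewrite dot_mulmx tr. Qed.

(** The matrices [p q], [p r], [q r] and [p q r] are skew-symmetric. *)
Lemma dot_skew_words (x : 'cV[R]_n) :
  [/\ dot x (p *m (q *m x)) = 0, dot x (p *m (r *m x)) = 0,
      dot x (q *m (r *m x)) = 0 & dot x (p *m (q *m (r *m x))) = 0].
Proof.
have z (a : R) : a = - a -> a = 0.
  by move=> /eqP; rewrite -addr_eq0 -mulr2n mulrn_eq0 => /eqP.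
split; apply: z; rewrite [LHS]dotC ?(dp, dq, dr) ?(words, mulmxN, opprK) dotNr //.
Qed.

Lemma clifford_frame_dual x (k l : 'I_4) : A x ->
  dot (nu k *m x) (E l *m x) = (k == l)%:R.
Proof.
move=> /hA [e1 e2 e3 e4]; have [e5 e6 e7 e8] := dot_skew_words x.
rewrite clifford_conormalsE clifford_frameE -(inj_eq val_inj).
case: k => [[|[|[|[|//]]]] hk]; case: l => [[|[|[|[|//]]]] hl] /=;
rewrite ?(dotNl, dp, dq, dr) ?(words, mulmxN, mulmxDr, opprK, opprD);
rewrite ?(dotDr, dotNr) ?(e1, e2, e3, e4, e5, e6, e7, e8); ring.
Qed.

End CliffordFrame.

(** * The complex structure of the quadrics *)

Section QuadricStructure.
Variables (R : realType) (n m : nat) (P : 'I_m -> 'M[R]_n).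
Hypothesis hP : clifford_system P.

Lemma clifford_sq i (x : 'cV[R]_n) : P i *m (P i *m x) = x.
Proof.
have n2 : 2 != 0 :> R by rewrite pnatr_eq0.
apply: (scalerI n2); rewrite !scaler_nat mulr2n mulmxA -mulmxDl hP.2 eqxx.
by rewrite mul_scalar_mx -scaler_nat scaler_nat.
Qed.

Lemma clifford_swap i j (x : 'cV[R]_n) : i != j ->
  P j *m (P i *m x) = - (P i *m (P j *m x)).
Proof.
move=> ij; apply/eqP; rewrite -addr_eq0 !mulmxA -mulmxDl hP.2 [j == i]eq_sym (negPf ij).
by rewrite mul0rn raddf0 mul0mx.
Qed.

(** The gradients [x] and [P_i x] are orthonormal on the quadric, so their
    combinations already realize every value of the differential. *)
Lemma quadric_submanifold : is_submanifold (clifford_quadric P).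
Proof.
exists (1 + m)%N => x qx.
have oT := @openT 'cV[R]_n; have sid := smooth_on_id oT.
pose G (y : 'cV[R]_n) : 'cV[R]_(1 + m) :=
  col_mx (const_mx (dot y y - 1)) (\col_i dot (P i *m y) y).
have hG y : is_diff y G (fun v => col_mx (const_mx (2 * dot y v)) (\col_i (2 * dot (P i *m y) v))).
  apply: is_diff_col_mx; apply: is_diff_mx => i j.
    have h := is_diff_add (is_diff_dot (is_diff_id y) (is_diff_id y)) (is_diff_const (-1 : R) y).
    rewrite (_ : (fun y => const_mx _ _ _) = fun y => dot y y - 1); last first.
      by apply/funext => z; rewrite mxE.
    by apply: (is_diff_ext h) => v; rewrite mxE addr0 (dotC v) mulr_natl mulr2n.
  have h := is_diff_dot (is_diff_lin (P i) (is_diff_id y)) (is_diff_id y).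
  rewrite (_ : (fun y => _ i j) = fun y => dot (P i *m y) y); last first.
    by apply/funext => z; rewrite mxE.
  apply: (is_diff_ext h) => v.
  by rewrite mxE /= (sym_dot _ _ (hP.1 i)) mulr_natl mulr2n.
exists setT, G; split=> //.
- apply: smooth_on_col_mx => //; apply: smooth_on_mx => // i j.
    rewrite (_ : (fun y => _) = fun y => dot y y + -1); last first.
      by apply/funext => z; rewrite mxE.
    by apply: smooth_on_add => //; [exact: smooth_on_dot|exact: smooth_on_const].
  rewrite (_ : (fun y => _) = fun y => dot (P i *m y) y); last first.
    by apply/funext => z; rewrite mxE.
  apply: smooth_on_dot => //; apply: smooth_on_mulmx => //; exact: smooth_on_const.
- move=> y _; split=> [[y1 yP]|].
    apply/eqP; rewrite col_mx_eq0; apply/andP; split; apply/eqP/matrixP => i j; rewrite !mxE.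
      by rewrite y1 subrr.
    exact: yP.
  move=> /eqP; rewrite col_mx_eq0 => /andP[/eqP e1 /eqP e2]; split.
    have := congr1 (fun M : 'cV[R]_1 => M 0 0) e1.
    by rewrite !mxE => /eqP; rewrite subr_eq0 => /eqP.
  by move=> i; have := congr1 (fun M : 'cV[R]_m => M i 0) e2; rewrite !mxE.
move=> w; pose a i := 2^-1 * dsubmx w i 0; pose b := 2^-1 * usubmx w 0 0.
exists (b *: x + clifford_comb P a *m x).
rewrite (is_diff_derive _ (hG x)) -[RHS]vsubmxK; congr col_mx; apply/matrixP => i j.
  rewrite !ord1 mxE dotDr dotZr (dotC x (clifford_comb P a *m x)) comb_dot.
  rewrite big1 => [|k _]; last first.
    by rewrite qx.2 mulr0.
  by rewrite addr0 qx.1 mulr1 mulrA mulfV ?pnatr_eq0 // mul1r.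
rewrite !ord1 mxE dotDr dotZr qx.2 mulr0 add0r (comb_dotP hP) qx.1 mulr1 mulrA.
by rewrite mulfV ?pnatr_eq0 // mul1r.
Qed.

Variables (i0 i1 i2 : 'I_m).
Hypotheses (n01 : i0 != i1) (n02 : i0 != i2) (n12 : i1 != i2).
Let p := P i0.
Let q := P i1.
Let r := P i2.
Let J0 := clifford_J0 p q r.
Let E := clifford_frame p q r.
Let nu := clifford_conormals p q r.
Hypothesis hother : forall k, k != i0 -> k != i1 -> k != i2 ->
  exists (l : 'I_m) (s : R), P k *m J0 = s *: P l.

Let A := clifford_quadric P.
Let pi := frame_proj E nu.
Definition quadric_J : 'cV[R]_n -> 'M[R]_n := frame_J J0 E nu.

Let pp (x : 'cV[R]_n) : p *m (p *m x) = x. Proof. exact: clifford_sq. Qed.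
Let qq (x : 'cV[R]_n) : q *m (q *m x) = x. Proof. exact: clifford_sq. Qed.
Let rr (x : 'cV[R]_n) : r *m (r *m x) = x. Proof. exact: clifford_sq. Qed.
Let qp (x : 'cV[R]_n) : q *m (p *m x) = - (p *m (q *m x)). Proof. exact: clifford_swap. Qed.
Let rp (x : 'cV[R]_n) : r *m (p *m x) = - (p *m (r *m x)). Proof. exact: clifford_swap. Qed.
Let rq (x : 'cV[R]_n) : r *m (q *m x) = - (q *m (r *m x)). Proof. exact: clifford_swap. Qed.
Let tp : p^T = p. Proof. exact: hP.1. Qed.
Let tq : q^T = q. Proof. exact: hP.1. Qed.
Let tr : r^T = r. Proof. exact: hP.1. Qed.

Let hA x : A x ->
  [/\ dot x x = 1, dot x (p *m x) = 0, dot x (q *m x) = 0 & dot x (r *m x) = 0].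
Proof. by move=> [x1 xP]; split=> //; rewrite dotC; exact: xP. Qed.

Let dual x k l : A x -> dot (nu k *m x) (E l *m x) = (k == l)%:R.
Proof. exact: (clifford_frame_dual tp tq tr pp qq rr qp rp rq hA). Qed.

Lemma quadric_piE x a : A x -> pi x *m (E a *m x) = 0.
Proof.
move=> Ax; rewrite frame_projE (bigD1 a) //= dual // eqxx scale1r big1 ?addr0 ?subrr //.
by move=> k /negPf ka; rewrite dual // ka scale0r.
Qed.

Let hJT x v : A x -> tangent A x v <-> forall k, dot (clifford_conormal P k x) v = 0.
Proof. by move=> Ax; have [] := quadric_conormal hP Ax. Qed.

Let nuT x v a : A x -> tangent A x v -> dot (nu a *m x) v = 0.
Proof.
move=> Ax /(hJT _ Ax) h; rewrite clifford_conormalsE.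
case: a => [[|[|[|[|//]]]] ha] /=.
- exact: (h (Some i1)).
- by rewrite dotNl (h (Some i2)) oppr0.
- exact: (h None).
- by rewrite dotNl (h (Some i0)) oppr0.
Qed.

Lemma quadric_piT x v : A x -> tangent A x v -> pi x *m v = v.
Proof.
move=> Ax tv; rewrite frame_projE big1 ?subr0 // => a _.
by rewrite nuT // scale0r.
Qed.

Let nu_pi x (w : 'cV[R]_n) a : A x -> dot (nu a *m x) (pi x *m w) = 0.
Proof.
move=> Ax; rewrite frame_projE dotBr dot_sumr (bigD1 a) //= dotZr dual // eqxx mulr1.
rewrite big1 ?addr0 ?subrr // => k /negPf ka.
by rewrite dotZr dual // eq_sym ka mulr0.
Qed.

(** Orthogonality to [x] and to the three chosen [P_i x] holds by duality.  Any
    other [P k] anticommutes with [J0] and [P k J0] is a multiple of some [P l], so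
    the remaining equations are the real and imaginary parts of a holomorphic
    one, preserved by [J0]; they are also preserved by the frame, because
    [P k P_i P_j] is skew-symmetric for distinct indices. *)
Lemma quadric_pi_tangent x v : A x -> tangent A x v -> tangent A x (pi x *m (J0 *m v)).
Proof.
move=> Ax tv; have /(hJT _ Ax) hv := tv; apply/(hJT _ Ax) => k.
have nuE (a : 'I_4) := @clifford_conormalsE R n p q r a x.
have npi a := nu_pi (J0 *m v) a Ax.
case: k => [k|] /=; last first.
  have := npi (inord 2); rewrite nuE inordK //=.
have [->|k0] := eqVneq k i0.
  have := npi (inord 3); rewrite nuE inordK //= dotNl => /eqP.
  by rewrite oppr_eq0 => /eqP.
have [->|k1] := eqVneq k i1.
  by have := npi (inord 0); rewrite nuE inordK.
have [->|k2] := eqVneq k i2.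
  have := npi (inord 1); rewrite nuE inordK //= dotNl => /eqP.
  by rewrite oppr_eq0 => /eqP.
have [l [s hl]] := hother k0 k1 k2.
set K := P k; have tK : K^T = K by exact: hP.1.
have Kp (y : 'cV[R]_n) : K *m (p *m y) = - (p *m (K *m y)).
  by apply: clifford_swap; rewrite eq_sym.
have Kq (y : 'cV[R]_n) : K *m (q *m y) = - (q *m (K *m y)).
  by apply: clifford_swap; rewrite eq_sym.
have Kr (y : 'cV[R]_n) : K *m (r *m y) = - (r *m (K *m y)).
  by apply: clifford_swap; rewrite eq_sym.
have KJ (y : 'cV[R]_n) : K *m (J0 *m y) = - (J0 *m (K *m y)).
  by rewrite !clifford_JE Kp Kq Kr !mulmxN opprK.
have KJl (y : 'cV[R]_n) : K *m (J0 *m y) = s *: (P l *m y).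
  by rewrite mulmxA hl -scalemxAl.
have JT : J0^T = - J0.
  apply: cV_eq => y; rewrite /J0 /clifford_J0 !trmx_mul tp tq tr mulNmx -!mulmxA.
  by rewrite rq !(mulmxN, qp, rp, opprK).
rewrite frame_projE dotBr dot_sumr.
have -> : dot (K *m x) (J0 *m v) = 0.
  rewrite dotC dot_mulmx JT mulNmx -KJ KJl dotZr dotC.
  by rewrite (hv (Some l)) mulr0.
rewrite big1 ?subr0 // => a _; rewrite dotZr.
have z (c : R) : c = - c -> c = 0.
  by move=> /eqP; rewrite -addr_eq0 -mulr2n mulrn_eq0 => /eqP.
have dP i (u w : 'cV[R]_n) : dot (P i *m u) w = dot u (P i *m w).
  by rewrite dot_mulmx hP.1.
have Ki i : k != i -> dot (K *m x) (P i *m x) = 0.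
  by move=> ki; rewrite (dotP hP) (negPf ki) mul0r.
have skew (i j : 'I_m) : i != j -> k != i -> k != j ->
    dot (K *m x) (P i *m (P j *m x)) = 0.
  move=> ij ki kj; apply: z; rewrite /K [LHS]dotC !dP (clifford_swap _ ij).
  rewrite [P k *m (P i *m _)]clifford_swap 1?eq_sym //.
  by rewrite [P k *m (P j *m _)]clifford_swap 1?eq_sym // mulmxN opprK dotNr.
have KJx : dot (K *m x) (p *m (q *m (r *m x))) = 0.
  by rewrite -clifford_JE dP KJl dotZr dotC Ax.2 mulr0.
have -> := @clifford_frameE _ _ p q r rp a x.
case: a => [[|[|[|[|//]]]] ha] /=; rewrite !(dotDr, dotBr, dotNr).
- by rewrite Ki // skew // addr0 mulr0.
- by rewrite Ki // skew // oppr0 addr0 mulr0.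
- by rewrite skew // addr0 Ax.2 mulr0.
- by rewrite KJx Ki // oppr0 addr0 mulr0.
Qed.

Let piJE x a : A x -> pi x *m (J0 *m (E a *m x)) = 0.
Proof.
move=> Ax; have [l [s ->]] := clifford_J0_frame pp qq rr qp rp rq a.
by rewrite -scalemxAr quadric_piE // scaler0.
Qed.

Let piC x a b : A x ->
  pi x *m (E a *m (E b *m x)) = pi x *m (E b *m (E a *m x)).
Proof.
move=> Ax; have [l [s ->]] := clifford_frame_comm pp qq rr qp rp rq a b.
by rewrite mulmxDr -scalemxAr quadric_piE // scaler0 addr0.
Qed.

Let J0J0 : J0 *m J0 = - 1%:M.
Proof. exact: (clifford_J0J0 pp qq rr qp rp rq). Qed.

Let EJ0 a : E a *m J0 = J0 *m E a.
Proof. exact: (clifford_frame_J0 pp qq rr qp rp rq). Qed.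

Lemma quadric_J_complex x v : A x -> tangent A x v ->
  tangent A x (quadric_J x *m v) /\ quadric_J x *m (quadric_J x *m v) = - v.
Proof. exact: (frame_J_complex J0J0 piJE quadric_piT quadric_pi_tangent). Qed.

Lemma smooth_quadric_J : smooth_on setT quadric_J.
Proof. exact: smooth_frame_J. Qed.

Lemma quadric_nij x u v : A x -> tangent A x u -> tangent A x v ->
  tangent A x (nij_form quadric_J x u v) -> nij_form quadric_J x u v = 0.
Proof. exact: (frame_nij_form EJ0 quadric_piE piJE piC quadric_piT). Qed.

Lemma quadric_complex_structure : admits_complex_structure A.
Proof.
split; first exact: quadric_submanifold.
exists quadric_J; split; last first.
  apply/integrable_at_diffW/(integrable_of_nij_form (quadric_conormal hP)).
  - by move=> x _; exact: (smooth_on_diff smooth_quadric_J).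
  - exact: quadric_J_complex.
  - exact: quadric_nij.
split; last exact: quadric_J_complex.
move=> x _; exists setT, quadric_J; split=> //; first exact: openT.
exact: smooth_quadric_J.
Qed.

End QuadricStructure.

(** * The two-sphere *)

Section Sphere.
Variable R : realType.
Implicit Types a b c u v z : 'cV[R]_3.

(** The matrix of the cross product by the k-th basis vector: in the i-th
    coordinate of [a x b], with indices modulo 3, the factor of [b_(i+1)] is
    [- a_(i+2)] and that of [b_(i+2)] is [a_(i+1)]. *)
Definition eps3 (k : 'I_3) : 'M[R]_3 := \matrix_(i, j)
  if j == ordS i then (k == ordS j)%:R * -1
  else if i == ordS j then (k == ordS i)%:R else 0.

Definition crossmx z : 'M[R]_3 := \sum_k z k 0 *: eps3 k.

Let o1 : 'I_3 := lift ord0 ord0.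
Let o2 : 'I_3 := lift ord0 (lift ord0 ord0).

Lemma dot3 a b : dot a b = a 0 0 * b 0 0 + a o1 0 * b o1 0 + a o2 0 * b o2 0.
Proof. by rewrite /dot !big_ord_recl big_ord0 addr0 addrA. Qed.

Lemma crossE a b : [/\ (crossmx a *m b) 0 0 = a o1 0 * b o2 0 - a o2 0 * b o1 0,
  (crossmx a *m b) o1 0 = a o2 0 * b 0 0 - a 0 0 * b o2 0 &
  (crossmx a *m b) o2 0 = a 0 0 * b o1 0 - a o1 0 * b 0 0].
Proof.
split; rewrite mxE !big_ord_recl big_ord0 /crossmx !summxE;
rewrite !big_ord_recl !big_ord0 !mxE -!val_eqE /=;
rewrite -/o1 -/o2; ring.
Qed.

Lemma cV3_eq a b : a 0 0 = b 0 0 -> a o1 0 = b o1 0 -> a o2 0 = b o2 0 -> a = b.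
Proof.
move=> e0 e1 e2; apply/matrixP => i j; rewrite !ord1.
have [->|n0] := eqVneq i 0; first by [].
have [->|n1] := eqVneq i o1; first by [].
by have -> : i = o2 by apply: val_inj; case: i n0 n1 => [[|[|[|]]]].
Qed.

Lemma cross_dot a b : dot a (crossmx a *m b) = 0.
Proof. by have [e0 e1 e2] := crossE a b; rewrite dot3 e0 e1 e2; ring. Qed.

Lemma cross_cross a b c :
  crossmx a *m (crossmx b *m c) = dot a c *: b - dot a b *: c.
Proof.
have [e0 e1 e2] := crossE a (crossmx b *m c); have [f0 f1 f2] := crossE b c.
by apply: cV3_eq; rewrite ?e0 ?e1 ?e2 ?f0 ?f1 ?f2 ![in RHS]mxE !dot3; ring.
Qed.

Lemma cross_crossl a b c :
  crossmx (crossmx a *m b) *m c = dot a c *: b - dot b c *: a.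
Proof.
have [e0 e1 e2] := crossE (crossmx a *m b) c; have [f0 f1 f2] := crossE a b.
by apply: cV3_eq; rewrite ?e0 ?e1 ?e2 ?f0 ?f1 ?f2 ![in RHS]mxE !dot3; ring.
Qed.

Lemma is_diff_cross z : is_diff z crossmx crossmx.
Proof.
have h k := is_diff_scalemx (is_diff_coord k 0 (is_diff_id z)) (is_diff_const (eps3 k) z).
apply: (is_diff_ext (is_diff_sum h)) => v.
by apply: eq_bigr => k _; rewrite scaler0 addr0.
Qed.

Lemma smooth_cross : smooth_on setT crossmx.
Proof. exact: (smooth_on_affine (@openT _) is_diff_cross). Qed.

(** The empty Clifford system, whose quadric is the whole sphere. *)
Definition no_clifford (i : 'I_0) : 'M[R]_3 := 0.

Lemma no_cliffordP : clifford_system no_clifford.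
Proof. by split; case. Qed.

Lemma sphere_quadric : @unit_sphere R 3 = clifford_quadric no_clifford.
Proof. by apply/seteqP; split=> x /=; [move=> x1; split=> // -[]|case]. Qed.

Lemma sphere_tangentP z v : unit_sphere z -> tangent (@unit_sphere R 3) z v <-> dot z v = 0.
Proof.
rewrite sphere_quadric => hz; have [h _] := quadric_conormal no_cliffordP hz.
rewrite h; split=> [/(_ None) //|e [[]//|]]; exact: e.
Qed.

Lemma cross_complex z v : unit_sphere z -> tangent (@unit_sphere R 3) z v ->
  tangent (@unit_sphere R 3) z (crossmx z *m v) /\ crossmx z *m (crossmx z *m v) = - v.
Proof.
move=> hz /(sphere_tangentP _ hz) e; split; first by apply/(sphere_tangentP _ hz); exact: cross_dot.
by rewrite cross_cross e (_ : dot z z = 1) // scale0r sub0r scale1r.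
Qed.

(** By the double cross product formulas, both [(p x u) x v] and [(p x v) x u] equal
    [- <u, v> p], and [u x v] is proportional to [p]. *)
Lemma cross_nij z u v : unit_sphere z -> tangent (@unit_sphere R 3) z u ->
  tangent (@unit_sphere R 3) z v -> nij_form crossmx z u v = 0.
Proof.
move=> hz /(sphere_tangentP _ hz) eu /(sphere_tangentP _ hz) ev.
have D w : 'D_w crossmx z = crossmx w by exact: is_diff_derive (is_diff_cross z).
rewrite /nij_form !D mulmxBr !cross_crossl !cross_cross eu ev (dotC v u).
by rewrite !scale0r !sub0r opprK addNr ?addr0 ?subr0 ?sub0r; vec_ring.
Qed.

End Sphere.

(** * Level hypersurfaces *)

Section Levels.
Variables (R : realType) (l m : nat) (P : 'I_m.+1 -> 'M[R]_(2 * l)).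
Hypothesis hP : clifford_system P.
Implicit Types x v y : 'cV[R]_(2 * l).

Lemma focal_plusE : focal_plus P = clifford_quadric P.
Proof.
apply/seteqP; split=> x; rewrite /focal_plus /FKM_level /= /FKM_poly.
  move=> [x1]; rewrite x1 expr1n => /eqP.
  rewrite subr_eq addrC -subr_eq subrr eq_sym mulf_eq0 pnatr_eq0 /= => e.
  split=> // i; apply/eqP; rewrite -sqrf_eq0.
  move: e; rewrite psumr_eq0 => [/allP /(_ i)|j _]; last exact: sqr_ge0.
  by rewrite mem_index_enum /= => ->.
move=> [x1 xP]; split=> //; rewrite x1 expr1n big1 ?mulr0 ?subr0 // => i _.
by rewrite xP expr0n.
Qed.

Variable c : R.
Hypothesis hc : -1 < c < 1.

Let s2 := (1 - c) / 2.
Let s := Num.sqrt s2.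

Let s2_gt0 : 0 < s2. Proof. by rewrite divr_gt0 // subr_gt0; case/andP: hc. Qed.
Let s2_lt1 : s2 < 1.
Proof. by have [c1 _] := andP hc; rewrite /s2 ltr_pdivrMr // mul1r; lra. Qed.
Let ss : s * s = s2. Proof. by rewrite -expr2 sqr_sqrtr // ltW. Qed.
Let s_gt0 : 0 < s. Proof. by rewrite sqrtr_gt0. Qed.
Let s_lt1 : s < 1.
Proof. by rewrite -(@ltr_pXn2r _ 2) ?nnegrE ?ler01 ?ltW // expr1n expr2 ss. Qed.

Lemma FKM_levelP x : FKM_level P c x <->
  dot x x = 1 /\ \sum_i dot (P i *m x) x ^+ 2 = s ^+ 2.
Proof.
rewrite /FKM_level /= /FKM_poly expr2 [s ^+ 2]expr2 ss /s2; split=> [[x1 e]|[x1 e]]; split=> //.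
  by rewrite x1 in e; lra.
by rewrite x1 e; field.
Qed.

(** The gradient of [sum_i w_i ^ 2] is proportional to [Q x], with
    [Q = sum_i w_i P_i].  The Gram matrix of [x] and [Q x] has determinant
    [s2 (1 - s2)], which is nonzero for [-1 < c < 1]. *)
Lemma FKM_level_submanifold : is_submanifold (FKM_level P c).
Proof.
exists (1 + 1)%N => x /FKM_levelP[x1 xs].
have oT := @openT 'cV[R]_(2 * l); have sid := smooth_on_id oT.
pose w (y : 'cV[R]_(2 * l)) i := dot (P i *m y) y.
pose h y : R := \sum_i w y i * w y i.
pose G (y : 'cV[R]_(2 * l)) : 'cV[R]_(1 + 1) :=
  col_mx (const_mx (dot y y + -1)) (const_mx (h y + - s ^+ 2)).
have hw y i : is_diff y (w ^~ i) (fun v => 2 * dot (P i *m y) v).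
  apply: (is_diff_ext (is_diff_dot (is_diff_lin (P i) (is_diff_id y)) (is_diff_id y))) => v.
  by rewrite /= (sym_dot _ _ (hP.1 i)) mulr_natl mulr2n.
have hh y : is_diff y h (fun v => 4 * dot (clifford_comb P (w y) *m y) v).
  apply: (is_diff_ext (is_diff_sum (fun i => is_diff_mul (hw y i) (hw y i)))) => v.
  rewrite /clifford_comb mulmx_suml dot_suml mulr_sumr; apply: eq_bigr => i _.
  by rewrite -scalemxAl dotZl /w; ring.
have hG y : is_diff y G (fun v => col_mx (const_mx (2 * dot y v))
    (const_mx (4 * dot (clifford_comb P (w y) *m y) v))).
  apply: is_diff_col_mx; apply: is_diff_mx => i j.
    have h1 := is_diff_add (is_diff_dot (is_diff_id y) (is_diff_id y)) (is_diff_const (-1 : R) y).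
    rewrite (_ : (fun y => const_mx _ _ _) = fun y => dot y y + -1); last first.
      by apply/funext => z; rewrite mxE.
    by apply: (is_diff_ext h1) => v; rewrite mxE addr0 (dotC v) mulr_natl mulr2n.
  have h1 := is_diff_add (hh y) (is_diff_const (- s ^+ 2 : R) y).
  rewrite (_ : (fun y => const_mx _ _ _) = fun y => h y + - s ^+ 2); last first.
    by apply/funext => z; rewrite mxE.
  by apply: (is_diff_ext h1) => v; rewrite mxE addr0.
have sw i : smooth_on setT (w ^~ i).
  by apply: smooth_on_dot => //; apply: smooth_on_mulmx => //; exact: smooth_on_const.
exists setT, G; split=> //.
- apply: smooth_on_col_mx => //; apply: smooth_on_mx => // i j.
    rewrite (_ : (fun y => _) = fun y => dot y y + -1); last first.
      by apply/funext => z; rewrite mxE.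
    by apply: smooth_on_add => //; [exact: smooth_on_dot|exact: smooth_on_const].
  rewrite (_ : (fun y => _) = fun y => h y + - s ^+ 2); last first.
    by apply/funext => z; rewrite mxE.
  apply: smooth_on_add => //; last exact: smooth_on_const.
  by apply: smooth_on_sum => // k; exact: smooth_on_mul.
- move=> y _; rewrite FKM_levelP; split=> [[y1 ys]|].
    apply/eqP; rewrite col_mx_eq0; apply/andP; split; apply/eqP/matrixP => i j; rewrite !mxE.
      by rewrite y1 subrr.
    by apply/eqP; rewrite -ys subr_eq0; apply/eqP/eq_bigr => k _; rewrite expr2.
  move=> /eqP; rewrite col_mx_eq0 => /andP[/eqP e1 /eqP e2]; split.
    have := congr1 (fun M : 'cV[R]_1 => M 0 0) e1.
    by rewrite !mxE => /eqP; rewrite subr_eq0 => /eqP.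
  have := congr1 (fun M : 'cV[R]_1 => M 0 0) e2.
  rewrite !mxE => /eqP; rewrite subr_eq0 => /eqP <-.
  by apply: eq_bigr => k _; rewrite expr2.
move=> W; pose W1 := usubmx W 0 0; pose W2 := dsubmx W 0 0.
(* The vector [a x + b Q x] has [dG = (2 (a + b s2), 4 s2 (a + b))]; solve for a, b. *)
pose b := (W1 / 2 - W2 / (4 * s2)) / (s2 - 1).
pose a := W1 / 2 - b * s2.
have s20 : s2 != 0 by rewrite gt_eqF.
have s21 : s2 - 1 != 0 by rewrite subr_eq0 lt_eqF.
have d1 : dot (clifford_comb P (w x) *m x) x = s2.
  by rewrite comb_dot -ss -expr2 -xs; apply: eq_bigr => i _; rewrite expr2.
have d2 : dot (clifford_comb P (w x) *m x) (clifford_comb P (w x) *m x) = s2.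
  by rewrite (comb_dotcl hP) x1 mulr1 -ss -expr2 -xs.
exists (a *: x + b *: (clifford_comb P (w x) *m x)).
rewrite (is_diff_derive _ (hG x)) -[RHS]vsubmxK; congr col_mx; apply/matrixP => i j.
  rewrite (ord1 i) (ord1 j) mxE dotDr !dotZr x1 (dotC x) d1 mulr1 subrK mulrC divfK ?pnatr_eq0 //.
rewrite (ord1 i) (ord1 j) mxE dotDr !dotZr d1 d2 -/W2 /a /b; field.
by rewrite s21.
Qed.

End Levels.

(** * Splitting a level hypersurface as a product *)

Section LevelProduct.
Variables (R : realType) (l m : nat) (P : 'I_m.+1 -> 'M[R]_(2 * l)).
Hypothesis hP : clifford_system P.
Implicit Types x v y : 'cV[R]_(2 * l).
Variable c : R.
Hypothesis hc : -1 < c < 1.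

Let s := Num.sqrt ((1 - c) / 2).
Let up := Num.sqrt (1 + s).
Let um := Num.sqrt (1 - s).
Let a := (up + um) / 2.
Let b := (up - um) / 2.
Let e := up * um.

Let s_gt0 : 0 < s.
Proof. by rewrite sqrtr_gt0 divr_gt0 // subr_gt0; case/andP: hc. Qed.

Let s_lt1 : s < 1.
Proof.
have [c1 c2] := andP hc.
rewrite -(@ltr_pXn2r _ 2) ?nnegrE ?ler01 ?ltW // expr1n sqr_sqrtr.
  by rewrite ltr_pdivrMr // mul1r; lra.
by rewrite ltW // divr_gt0 // subr_gt0.
Qed.

Let upup : up * up = 1 + s.
Proof. by rewrite -expr2 sqr_sqrtr // addr_ge0 ?ltW. Qed.
Let umum : um * um = 1 - s.
Proof. by rewrite -expr2 sqr_sqrtr // subr_ge0 ltW. Qed.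
Let e_neq0 : e != 0.
Proof. by rewrite gt_eqF // mulr_gt0 // sqrtr_gt0 ?subr_gt0 // addr_gt0. Qed.
Let s_neq0 : s != 0. Proof. by rewrite gt_eqF. Qed.
Let ab1 : a * a + b * b = 1.
Proof.
have -> : a * a + b * b = (up * up + um * um) / 2 by rewrite /a /b; field.
by rewrite upup umum; field.
Qed.
Let ab2 : 2 * (a * b) = s.
Proof.
have -> : 2 * (a * b) = (up * up - um * um) / 2 by rewrite /a /b; field.
by rewrite upup umum; field.
Qed.
Let ab3 : a * a - b * b = e. Proof. by rewrite /a /b /e; field. Qed.
Let e2 : e * e = 1 - s * s.
Proof. by rewrite /e mulrACA upup umum; ring. Qed.

Let w x i := dot (P i *m x) x.

(** The point [u] of the sphere is [w / s]; the other component is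
    [(a - b Q) / (a^2 - b^2)] applied to [x], the inverse of [a + b Q] since
    [Q^2 = 1]. *)
Definition level_split x : 'cV[R]_(2 * l + m.+1) :=
  col_mx ((a / e) *: x + clifford_comb P (fun i => (- b / e / s) * w x i) *m x)
         (\col_i (s^-1 * w x i)).

Definition level_join (z : 'cV[R]_(2 * l + m.+1)) : 'cV[R]_(2 * l) :=
  a *: usubmx z + clifford_comb P (fun i => b * dsubmx z i 0) *m usubmx z.

Lemma smooth_level_split : smooth_on setT level_split.
Proof.
have oT := @openT 'cV[R]_(2 * l); have sid := smooth_on_id oT.
have sw i : smooth_on setT (fun x => w x i).
  by apply: smooth_on_dot => //; apply: smooth_on_mulmx => //; exact: smooth_on_const.
have sc (k : R) i : smooth_on setT (fun x => k * w x i).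
  by apply: smooth_on_mul => //; exact: smooth_on_const.
apply: smooth_on_col_mx => //.
  apply: smooth_on_addmx => //.
    by apply: smooth_on_scalemx => //; exact: smooth_on_const.
  apply: smooth_on_mulmx => //; apply: smooth_on_summx => // i.
  by apply: smooth_on_scalemx => //; exact: smooth_on_const.
apply: smooth_on_mx => // i j.
rewrite (_ : (fun x => _) = fun x => s^-1 * w x i); first exact: sc.
by apply/funext => x; rewrite mxE.
Qed.

Lemma smooth_level_join : smooth_on setT level_join.
Proof.
have oT := @openT 'cV[R]_(2 * l + m.+1).
have su := @smooth_on_usubmx R (2 * l) m.+1 _ oT.
have sd := @smooth_on_dsubmx R (2 * l) m.+1 _ oT.
apply: smooth_on_addmx => //.
  by apply: smooth_on_scalemx => //; exact: smooth_on_const.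
apply: smooth_on_mulmx => //; apply: smooth_on_summx => // i.
apply: smooth_on_scalemx => //; last exact: smooth_on_const.
by apply: smooth_on_mul => //; [exact: smooth_on_const|exact: smooth_on_coord].
Qed.

Let clZ k (u : 'I_m.+1 -> R) : clifford_comb P (fun i => k * u i) = k *: clifford_comb P u.
Proof. by rewrite /clifford_comb scaler_sumr; apply: eq_bigr => i _; rewrite scalerA. Qed.

Let levelP x : FKM_level P c x <->
  dot x x = 1 /\ \sum_i w x i ^+ 2 = s ^+ 2.
Proof. exact: FKM_levelP. Qed.

Lemma level_split_in x : FKM_level P c x ->
  set_prod (focal_plus P) (@unit_sphere R m.+1) (level_split x).
Proof.
move=> /levelP[x1 xs]; rewrite focal_plusE /set_prod /= /level_split col_mxKu col_mxKd.
have pE : \sum_i (- b / e / s) * w x i * w x i = - b / e * s.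
  rewrite -[X in _ = _ * X](mulfK s_neq0 s) -expr2 -xs mulr_suml mulr_sumr.
  by apply: eq_bigr => i _; field; rewrite e_neq0 s_neq0.
have p2 : \sum_i ((- b / e / s) * w x i) ^+ 2 = b * b / (e * e).
  transitivity (b * b / (e * e) / s ^+ 2 * (\sum_i w x i ^+ 2)).
    by rewrite mulr_sumr; apply: eq_bigr => i _; field; rewrite e_neq0 s_neq0.
  by rewrite xs; field; rewrite e_neq0 s_neq0.
split; last first.
  rewrite /unit_sphere /= /dot.
  transitivity ((s ^+ 2)^-1 * \sum_i w x i ^+ 2).
    by rewrite mulr_sumr; apply: eq_bigr => i _; rewrite !mxE; field.
  by rewrite xs mulVf // expf_neq0.
split=> [|j].
  rewrite (dot_comb hP) pE p2 x1.
  have -> : (a / e) ^+ 2 * 1 + 2 * (a / e) * (- b / e * s) + b * b / (e * e) * 1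
     = ((a * a + b * b) - 2 * (a * b) * s) / (e * e) by field.
  by rewrite ab1 ab2 -e2 mulfV // mulf_neq0.
rewrite (dotP_comb hP) pE p2 x1 -/(w x j).
have -> : ((a / e) ^+ 2 - b * b / (e * e)) * w x j +
   2 * (- b / e / s * w x j) * (a / e * 1 + - b / e * s) =
   w x j / (e * e) / s * ((a * a - b * b) * s -
     (2 * (a * b) - (a * a + b * b - (a * a - b * b)) * s)).
  by field; rewrite e_neq0 s_neq0.
by rewrite ab1 ab2 ab3; field; rewrite e_neq0 s_neq0.
Qed.

Lemma level_splitK x : FKM_level P c x -> level_join (level_split x) = x.
Proof.
move=> /levelP[x1 xs]; rewrite /level_join /level_split col_mxKu col_mxKd.
have -> : (fun i => b * (\col_i (s^-1 * w x i)) i 0) = (fun i => (b / s) * w x i).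
  by apply/funext => i; rewrite mxE mulrA.
rewrite !clZ; set Q := clifford_comb P (w x).
have QQ : Q *m (Q *m x) = s ^+ 2 *: x by rewrite mulmxA (comb_sq hP) mul_scalar_mx xs.
rewrite -!scalemxAl mulmxDr -!scalemxAr QQ.
move: (Q *m x) => y.
transitivity (((a * a - b * b) / e) *: x); last by rewrite ab3 mulfV // scale1r.
by apply/matrixP => i j; rewrite !mxE; field; rewrite e_neq0 s_neq0.
Qed.

Let join_data z : set_prod (focal_plus P) (@unit_sphere R m.+1) z ->
  [/\ dot (usubmx z) (usubmx z) = 1, forall i, w (usubmx z) i = 0,
      \sum_i dsubmx z i 0 ^+ 2 = 1,
      dot (level_join z) (level_join z) = 1 &
      forall i, w (level_join z) i = s * dsubmx z i 0].
Proof.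
rewrite focal_plusE => -[[y1 yP] u1].
have u2 : \sum_i dsubmx z i 0 ^+ 2 = 1.
  by rewrite -u1; apply: eq_bigr => i _; rewrite expr2.
have pE : \sum_i b * dsubmx z i 0 * dot (P i *m usubmx z) (usubmx z) = 0.
  by rewrite big1 // => i _; rewrite yP mulr0.
have p2 : \sum_i (b * dsubmx z i 0) ^+ 2 = b * b.
  rewrite -[RHS]mulr1 -u2 mulr_sumr; apply: eq_bigr => i _; ring.
split=> //.
  by rewrite (dot_comb hP) pE p2 y1 mulr0 addr0 !mulr1 expr2.
move=> i; rewrite /w (dotP_comb hP) pE yP y1 -ab2; ring.
Qed.

Lemma level_join_in z : set_prod (focal_plus P) (@unit_sphere R m.+1) z ->
  FKM_level P c (level_join z).
Proof.
move=> /join_data[_ _ u2 x1 xw]; apply/levelP; split=> //.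
rewrite -[RHS]mulr1 -u2 mulr_sumr; apply: eq_bigr => i _.
by rewrite xw exprMn.
Qed.

Lemma level_joinK z : set_prod (focal_plus P) (@unit_sphere R m.+1) z ->
  level_split (level_join z) = z.
Proof.
move=> /join_data[y1 yP u2 x1 xw]; rewrite /level_split -[RHS]vsubmxK; congr col_mx; last first.
  by apply/matrixP => i j; rewrite (ord1 j) mxE xw mulKf.
have -> : (fun i => - b / e / s * w (level_join z) i) = (fun i => (- b / e) * dsubmx z i 0).
  by apply/funext => i; rewrite xw; field; rewrite e_neq0 s_neq0.
rewrite /level_join !clZ; set Q := clifford_comb P (fun i => dsubmx z i 0); set y := usubmx z.
have QQ : Q *m (Q *m y) = y by rewrite mulmxA (comb_sq hP) mul_scalar_mx u2 scale1r.
rewrite -!scalemxAl mulmxDr -!scalemxAr QQ.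
move: (Q *m y) => y'.
transitivity (((a * a - b * b) / e) *: y); last by rewrite ab3 mulfV // scale1r.
by apply/matrixP => i j; rewrite !mxE; field.
Qed.

Lemma level_diffeomorphic :
  diffeomorphic (FKM_level P c) (set_prod (focal_plus P) (@unit_sphere R m.+1)).
Proof.
exists level_split, level_join; split.
- by move=> x _; exists setT, level_split; split=> //; [exact: openT|exact: smooth_level_split].
- by move=> x _; exists setT, level_join; split=> //; [exact: openT|exact: smooth_level_join].
- by move=> x hx; split; [exact: level_split_in|exact: level_splitK].
- by move=> x hx; split; [exact: level_join_in|exact: level_joinK].
Qed.

End LevelProduct.

(** * Complex structures on focal submanifolds and isoparametric hypersurfaces *)

Theorem theorem2 (R : realType) :
  (forall (l : nat) (P : 'I_(2.+1) -> 'M[R]_(2 * l)), OT_FKM P ->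
     admits_complex_structure (focal_plus P) /\
     (forall c : R, -1 < c < 1 ->
        diffeomorphic (FKM_level P c)
          (set_prod (focal_plus P) (@unit_sphere R 3)) /\
        admits_complex_structure (FKM_level P c))) /\
  (forall (l : nat) (P : 'I_(4.+1) -> 'M[R]_(2 * l)), OT_FKM P -> definite P ->
     admits_complex_structure (focal_plus P)).
Proof.
split=> [l P [_ hP _ _]|l P [_ hP _ _] hdef].
- have n01 : (inord 0 : 'I_3) != inord 1 by rewrite -val_eqE /= !inordK.
  have n02 : (inord 0 : 'I_3) != inord 2 by rewrite -val_eqE /= !inordK.
  have n12 : (inord 1 : 'I_3) != inord 2 by rewrite -val_eqE /= !inordK.
  have hother (k : 'I_3) : k != inord 0 -> k != inord 1 -> k != inord 2 ->
      exists (l' : 'I_3) (s : R), P k *m clifford_J0 (P (inord 0)) (P (inord 1)) (P (inord 2))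
        = s *: P l'.
    by case: k => [[|[|[|//]]] hk]; rewrite -!val_eqE /= !inordK.
  split; first by rewrite focal_plusE; exact: (quadric_complex_structure hP n01 n02 n12 hother).
  move=> c hc; have hd := level_diffeomorphic hP hc; split=> //.
  split; first exact: FKM_level_submanifold.
  pose JQ := quadric_J P (inord 0) (inord 1) (inord 2).
  pose JB := J_prod JQ (@crossmx R).
  have sJQ : smooth_on setT JQ by exact: smooth_quadric_J.
  have sJ : smooth_on setT JB by apply: smooth_J_prod => //; exact: smooth_cross.
  pose B := set_prod (focal_plus P) (@unit_sphere R 3).
  have JT z w : B z -> tangent B z w ->
      tangent B z (JB z *m w) /\ JB z *m (JB z *m w) = - w.
    rewrite /B focal_plusE; apply: J_prod_complex; last exact: cross_complex.
    exact: (quadric_J_complex hP n01 n02 n12 hother).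
  have cB : conormal B (conormal_prod (clifford_conormal P) (clifford_conormal (@no_clifford R))).
    rewrite /B focal_plusE sphere_quadric; apply: conormal_prodP; apply: quadric_conormal => //.
    exact: no_cliffordP.
  have JI : integrable_at_diff B JB.
    apply: (integrable_of_nij_form cB) => //.
      by move=> z _; exact: (smooth_on_diff sJ).
    move=> z u v [zA zB] /tangent_prod[uA uB] /tangent_prod[vA vB] /tangent_prod.
    rewrite /JB nij_form_prod //; last exact: smooth_cross.
    rewrite col_mxKu col_mxKd => -[tN _].
    rewrite (cross_nij zB uB vB); move: zA uA vA tN; rewrite focal_plusE => zA uA vA tN.
    by rewrite (quadric_nij hP n01 n02 n12 zA uA vA tN) col_mx0.
  have sf := @smooth_level_split R l 2 P c.
  have sg := @smooth_level_join R l 2 P c.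
  have fAB := level_split_in hP hc; have fK := level_splitK hP hc.
  have gBA := level_join_in hP hc; have gK := level_joinK hP hc.
  exists (pull_J (level_split P c) (level_join P c) JB); split.
    split; last exact: (pull_J_complex sf sg fAB fK gBA gK JT).
    move=> x _; exists setT, (pull_J (level_split P c) (level_join P c) JB).
    by split=> //; [exact: openT|exact: smooth_pull_J].
  apply: integrable_at_diffW.
  exact: (pull_J_integrable sf sg fAB fK gBA gK cB sJ JT JI).
rewrite focal_plusE //.
have n01 : (inord 0 : 'I_5) != inord 1 by rewrite -val_eqE /= !inordK.
have n02 : (inord 0 : 'I_5) != inord 2 by rewrite -val_eqE /= !inordK.
have n12 : (inord 1 : 'I_5) != inord 2 by rewrite -val_eqE /= !inordK.
set i0 : 'I_5 := inord 0; set i1 : 'I_5 := inord 1; set i2 : 'I_5 := inord 2.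
pose i3 : 'I_5 := inord 3; pose i4 : 'I_5 := inord 4.
(* The product of the five matrices is a sign, hence [J0 = +- P_4 P_3]. *)
have [eps J34] : exists eps : R,
    forall x : 'cV[R]_(2 * l),
      clifford_J0 (P i0) (P i1) (P i2) *m x = eps *: (P i4 *m (P i3 *m x)).
  have prodE (x : 'cV[R]_(2 * l)) : (\big[mulmx/1%:M]_(i < 5) P i) *m x =
      clifford_J0 (P i0) (P i1) (P i2) *m (P i3 *m (P i4 *m x)).
    rewrite !big_ord_recl big_ord0 mulmx1 /clifford_J0 -!mulmxA.
    by do 5?[congr (P _ *m _); first by apply: val_inj; rewrite /= /bump inordK].
  have [eps he] : exists eps : R, forall x : 'cV[R]_(2 * l),
      (\big[mulmx/1%:M]_(i < 5) P i) *m x = eps *: x.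
    by case: hdef => ->; [exists 1|exists (-1)] => x;
      rewrite ?mulNmx mul1mx ?scale1r ?scaleN1r.
  by exists eps => x; rewrite -he prodE !(clifford_sq hP).
apply: (quadric_complex_structure hP n01 n02 n12) => k k0 k1 k2.
have [k3|k3] := eqVneq k i3.
  exists i4, (- eps); rewrite k3; apply: cV_eq => x.
  rewrite -mulmxA J34 -scalemxAr (@clifford_swap _ _ _ _ hP i4 i3).
    by rewrite (clifford_sq hP) scalerN -scaleNr -scalemxAl.
  by rewrite -val_eqE /= !inordK.
have -> : k = i4.
  apply: val_inj; rewrite /= inordK //.
  move: k0 k1 k2 k3; rewrite -!val_eqE /= !inordK //.
  by case: k => [[|[|[|[|[|]]]]] hk].
exists i3, eps; apply: cV_eq => x.
by rewrite -mulmxA J34 -scalemxAr (clifford_sq hP) -scalemxAl.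
Qed.
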